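(* Let $X$ be a nonempty completely regular space, $\mu$ a Borel measure on $X$ with support equal to the whole of $X$, $E\neq\{0\}$ a Banach space and $D=L^\infty_\mu(X,E)$. Let $A=C(X,L(E))\subset L(D)$ act by multiplication, $(af)(x)=a(x)f(x)$. Let $G$ be a discrete group, $\{t_g\}_{g\in G}$ a group of homeomorphisms of $X$ ($t_{gh}=t_g\circ t_h$) preserving the equivalence class of $\mu$, and let $T_g$ be the isometry of $D$ given by $(T_gf)(x)=f(t_g^{-1}(x))$. Let $B(A,T_g)\subset L(D)$ be the algebra generated by $A$ and $\{T_g\}_{g\in G}$ and let $B(\bar A,V_g)$ be the corresponding regular representation in the space $H=l_0(G,L^\infty_\mu(X,E))$ (or $H=l^\infty(G,L^\infty_\mu(X,E))$). If $G$ acts topologically freely on $X$, then $$B(A,T_g)\cong B(\bar A,V_g),$$ where the isomorphism is generated by the mappings $a\mapsto\bar a$ ($a\in A$) and $T_g\mapsto V_g$ ($g\in G$); in particular, $B(A,T_g)$ possesses the properties ( * ), ( ** ) and the property that for every finite $F\subset G$, all $a_g\in A$ and every character $\chi$ of $G$, $\|\sum_{g\in F}a_gT_g\|=\|\sum_{g\in F}a_g\chi(g)T_g\|$.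
   Context: All Banach spaces are complex, completely regular spaces are Hausdorff. $L(E)$ is the algebra of bounded linear operators on $E$; $C(X,B)$ is the space of bounded continuous functions $X\to B$ with the sup norm. $l_0(G,D)$ is the space of functions $G\to D$ tending to zero at infinity, with the sup norm. Preserving the equivalence class of $\mu$ means that for each $g\in G$ the measure $Q\mapsto\mu(t_g^{-1}(Q))$ is absolutely continuous with respect to $\mu$. A character of $G$ is a homomorphism from $G$ to the unit circle. $\hat T_g(a)=T_gaT_g^{-1}$, so $(\hat T_g(a))(x)=a(t_g^{-1}(x))$. $B(A,T_g)$ is the norm closure in $L(D)$ of the finite sums $\sum_{g\in F}a_gT_g$, $a_g\in A$. Regular representation in a space $H$ of $D$-valued functions on $G$: $(V_{g_0}\xi)(g)=\xi(gg_0)$, and for $a\in A$, $(\bar a\xi)(g)=\hat T_g(a)\xi(g)$; $\bar A=\{\bar a:a\in A\}\subset L(H)$; $B(\bar A,V_g)$ is the norm closure in $L(H)$ of the finite sums $\sum\bar a_gV_g$. ''$\cong$'' is isometric isomorphism of Banach algebras. Topologically free action: for every $g\ne e$ the set $\{x\in X:t_g(x)=x\}$ has empty interior. Property ( * ): $\|\sum a_gT_g\|\ge\|a_e\|$ for every finite sum with $a_g\in A$. Then for each $g_0\in G$ the map $N_{g_0}:\sum a_gT_g\mapsto a_{g_0}$ is well defined on finite sums and extends by continuity to $N_{g_0}:B(A,T_g)\to A$. Property ( ** ): ( * ) holds and for $b\in B(A,T_g)$, $b=0$ iff $N_g(b)=0$ for every $g\in G$. *)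

(* Defs.v *)
From HB Require Import structures.
From mathcomp Require Import all_boot all_order all_algebra finmap.
From mathcomp Require Import complex.
From mathcomp Require Import all_classical all_reals all_analysis ess_sup_inf.
Set Implicit Arguments.
Unset Strict Implicit.
Unset Printing Implicit Defensive.
Import Order.TTheory GRing.Theory Num.Theory.
Import numFieldNormedType.Exports.
Local Open Scope classical_set_scope.
Local Open Scope ring_scope.
Local Open Scope complex_scope.

Section real_norm.
Context {R : realType} {V : normedModType R[i]}.
Implicit Types x y : V.

(* The norm of a complex normed space takes its values in [R[i]]; [nrm] is the
   same norm with values in [R], where suprema are available. *)
Definition nrm x : R := complex.Re `|x|.

Lemma nrmE x : `|x| = (nrm x)%:C.
Proof. by rewrite /nrm RRe_real// ger0_real. Qed.

Lemma nrm_ge0 x : 0 <= nrm x.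
Proof. by rewrite -(@ler0c R) -nrmE. Qed.

Lemma nrm0 : nrm 0 = 0.
Proof. by apply: complexI; rewrite -nrmE normr0. Qed.

Lemma nrm_eq0 x : nrm x = 0 -> x = 0.
Proof. by move=> x0; apply/normr0_eq0; rewrite nrmE x0. Qed.

Lemma nrmD x y : nrm (x + y) <= nrm x + nrm y.
Proof. by rewrite -lecR rmorphD /= -!nrmE ler_normD. Qed.

End real_norm.

Lemma nrmZ (R : realType) (V : normedModType R[i]) (l : R[i]) (x : V) :
  nrm (l *: x) = nrm (l : R[i]^o) * nrm x.
Proof. by apply: complexI; rewrite rmorphM /= -!nrmE normrZ. Qed.

Section sup_norm.
Context {R : realType} {I : Type} {V : normedModType R[i]}.
Implicit Types (A : set I) (f g : I -> V).

Definition bounded_on A f := exists M : R, forall i, A i -> nrm (f i) <= M.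

Definition sup_norm A f : R := sup [set nrm (f i) | i in A].

Lemma sup_norm_ub A f i : bounded_on A f -> A i -> nrm (f i) <= sup_norm A f.
Proof.
move=> [M fM] Ai; apply: ub_le_sup; last by exists i.
by exists M => _ [j Aj <-]; exact: fM.
Qed.

Lemma sup_norm_le A f M :
  0 <= M -> (forall i, A i -> nrm (f i) <= M) -> sup_norm A f <= M.
Proof.
move=> M0 fM; have [->|/set0P[i Ai]] := eqVneq A set0.
  by rewrite /sup_norm image_set0 sup0.
apply: ge_sup; first by exists (nrm (f i)); exists i.
by move=> _ [j Aj <-]; exact: fM.
Qed.

Lemma sup_norm_ge0 A f : bounded_on A f -> 0 <= sup_norm A f.
Proof.
move=> bf; have [->|/set0P[i Ai]] := eqVneq A set0.
  by rewrite /sup_norm image_set0 sup0.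
exact: le_trans (nrm_ge0 _) (sup_norm_ub bf Ai).
Qed.

Lemma bounded_on0 A : bounded_on A (0 : I -> V).
Proof. by exists 0 => i _; rewrite nrm0. Qed.

Lemma bounded_onZD A (l : R[i]) f g :
  bounded_on A f -> bounded_on A g -> bounded_on A (l *: f + g).
Proof.
move=> [M fM] [N gN]; exists (nrm (l : R[i]^o) * M + N) => i Ai.
apply: le_trans (nrmD _ _) _; rewrite nrmZ lerD ?gN//.
by rewrite ler_wpM2l ?nrm_ge0 ?fM.
Qed.

Lemma sup_normD A f g : bounded_on A f -> bounded_on A g ->
  sup_norm A (f + g) <= sup_norm A f + sup_norm A g.
Proof.
move=> bf bg; apply: sup_norm_le => [|i Ai].
  by rewrite addr_ge0 ?sup_norm_ge0.
by apply: le_trans (nrmD _ _) _; rewrite lerD ?sup_norm_ub.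
Qed.

Lemma sup_normZ A (l : R[i]) f : bounded_on A f ->
  sup_norm A (l *: f) = nrm (l : R[i]^o) * sup_norm A f.
Proof.
have le k h : bounded_on A h ->
    sup_norm A (k *: h) <= nrm (k : R[i]^o) * sup_norm A h.
  move=> bh; apply: sup_norm_le => [|i Ai].
    by rewrite mulr_ge0 ?nrm_ge0 ?sup_norm_ge0.
  by rewrite nrmZ ler_wpM2l ?nrm_ge0 ?sup_norm_ub.
move=> bf; apply/le_anti; rewrite le//=.
have [->|l0] := eqVneq l 0; first by rewrite nrm0 mul0r scale0r sup_norm_ge0//; exact: bounded_on0.
have blf : bounded_on A (l *: f).
  by rewrite -[l *: f]addr0; apply: bounded_onZD => //; exact: bounded_on0.
have lgt0 : 0 < nrm (l : R[i]^o).
  by rewrite lt_neqAle nrm_ge0 andbT eq_sym; apply: contra_neq l0; exact: nrm_eq0.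
have := le l^-1 _ blf; rewrite scalerA mulVf// scale1r.
rewrite (_ : nrm (l^-1 : R[i]^o) = (nrm (l : R[i]^o))^-1); last first.
  by apply: complexI; rewrite fmorphV /= -!nrmE normfV.
by rewrite -ler_pdivlMl// invrK.
Qed.

Lemma sup_norm_eq0 A f i : bounded_on A f -> sup_norm A f = 0 -> A i -> f i = 0.
Proof.
move=> bf f0 Ai; apply/nrm_eq0/le_anti.
by rewrite nrm_ge0 andbT -f0 sup_norm_ub.
Qed.

End sup_norm.

Section bounded_operators.
Context {R : realType}.
Variables V W : normedModType R[i].

Definition closed_unit_ball : set V := [set x | nrm x <= 1].

Definition bounded_operator : {pred V -> W} :=
  mem [set f | linear f /\ bounded_on closed_unit_ball f].

Lemma bounded_operator_submod_closed : submod_closed bounded_operator.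
Proof.
split=> [|l f g]; rewrite !inE /=.
  by split; [move=> a x y; rewrite scaler0 addr0|exact: bounded_on0].
move=> [lf bf] [lg bg]; split; last exact: bounded_onZD.
by move=> a x y; rewrite !fctE/= lf lg !scalerDr !scalerA [l * a]mulrC addrACA.
Qed.

HB.instance Definition _ := GRing.isSubmodClosed.Build R[i] (V -> W)
  bounded_operator bounded_operator_submod_closed.

Record bop := Bop { bop_val :> V -> W; bopP : bop_val \in bounded_operator }.

HB.instance Definition _ := [isSub for bop_val].
HB.instance Definition _ := [Choice of bop by <:].
HB.instance Definition _ := [SubChoice_isSubLmodule of bop by <:].

Lemma bop_linear (S : bop) : linear S.
Proof. by have := bopP S; rewrite inE => -[]. Qed.

HB.instance Definition _ (S : bop) :=
  GRing.isLinear.Build R[i] V W _ S (@bop_linear S).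

Lemma bop_bounded (S : bop) : bounded_on closed_unit_ball S.
Proof. by have := bopP S; rewrite inE => -[]. Qed.

Definition bop_norm (S : bop) : R[i] := (sup_norm closed_unit_ball S)%:C.

Lemma bop_normD (S T : bop) : bop_norm (S + T) <= bop_norm S + bop_norm T.
Proof. by rewrite -rmorphD/= lecR; apply: sup_normD; exact: bop_bounded. Qed.

Lemma bop_normZ (l : R[i]) (S : bop) : bop_norm (l *: S) = `|l| * bop_norm S.
Proof.
by rewrite /bop_norm (sup_normZ _ (bop_bounded S)) rmorphM/=; congr (_ * _).
Qed.

Lemma bop_norm_eq0 (S : bop) : bop_norm S = 0 -> S = 0.
Proof.
move=> /(@complexI _ _ 0) S0; apply/val_inj/funext => x /=.
have [->|x0] := eqVneq x 0; first exact: linear0.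
have n0 : `|x| != 0 by rewrite normr_eq0.
apply: (scalerI (invr_neq0 n0)); rewrite scaler0 -linearZ/=.
apply: (sup_norm_eq0 (bop_bounded S) S0).
by rewrite /closed_unit_ball /= -lecR -nrmE normfZV.
Qed.

HB.instance Definition _ := Lmodule_isNormed.Build R[i] bop
  bop_normD bop_normZ bop_norm_eq0.

Lemma nrm_bop (S : bop) : nrm S = sup_norm closed_unit_ball S.
Proof. by apply: complexI; rewrite -nrmE. Qed.

Lemma bop_le (S : bop) x : nrm (S x) <= nrm S * nrm x.
Proof.
have [->|x0] := eqVneq x 0; first by rewrite linear0 !nrm0 mulr0.
have n0 : 0 < nrm x.
  by rewrite lt_neqAle nrm_ge0 andbT eq_sym; apply: contra_neq x0; exact: nrm_eq0.
have : nrm (S (`|x|^-1 *: x)) <= nrm S.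
  rewrite nrm_bop; apply: sup_norm_ub; first exact: bop_bounded.
  by rewrite /closed_unit_ball /= -lecR -nrmE normfZV.
rewrite linearZ/= nrmZ.
rewrite (_ : nrm (`|x|^-1 : R[i]^o) = (nrm x)^-1); last first.
  by apply: complexI; rewrite fmorphV/= -!nrmE normfV normr_id.
by rewrite ler_pdivrMl// mulrC.
Qed.

Lemma bop_nrm_le (S : bop) M :
  0 <= M -> (forall x, nrm (S x) <= M * nrm x) -> nrm S <= M.
Proof.
move=> M0 SM; rewrite nrm_bop; apply: sup_norm_le => // x x1.
by rewrite (le_trans (SM x))// ler_piMr.
Qed.

(* builds an operator from a bound on the whole space *)
Lemma mk_bop_subproof (f : V -> W) : linear f ->
  (exists M : R, forall x, nrm (f x) <= M * nrm x) -> f \in bounded_operator.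
Proof.
move=> lf [M fM]; rewrite inE; split=> //; exists `|M| => x x1.
rewrite (le_trans (fM x))// (@le_trans _ _ (`|M| * nrm x))//.
  by rewrite ler_wpM2r ?nrm_ge0 ?ler_norm.
by rewrite ler_piMr.
Qed.

Definition mk_bop (f : V -> W) lf bf : bop := Bop (@mk_bop_subproof f lf bf).

End bounded_operators.
Arguments bounded_operator {R} V W _.
Arguments closed_unit_ball {R} V _.
Arguments mk_bop {R V W}.

Notation "'L( E )" := (bop E E) (at level 8, format "''L(' E ')'") : type_scope.

Section composition.
Context {R : realType} {U V W : normedModType R[i]}.

Lemma bop_comp_subproof (S : bop V W) (T : bop U V) :
  (S \o T : U -> W) \in bounded_operator U W.
Proof.
apply: mk_bop_subproof => [a x y|/=]; first by rewrite /= !linearP.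
exists (nrm S * nrm T) => x; rewrite (le_trans (bop_le _ _))// -mulrA.
by rewrite ler_wpM2l ?nrm_ge0 ?bop_le.
Qed.

Definition bop_comp S T : bop U W := Bop (bop_comp_subproof S T).

End composition.

Notation "S ∘ T" := (bop_comp S T) (at level 40, left associativity) : ring_scope.

Section bounded_continuous_functions.
Context {R : realType}.
Variables (X : topologicalType) (B : normedModType R[i]).

Definition bounded_continuous : {pred X -> B} :=
  mem [set f | continuous f /\ bounded_on setT f].

Lemma bounded_continuous_submod_closed : submod_closed bounded_continuous.
Proof.
split=> [|l f g]; rewrite !inE /=.
  split; [by move=> x; exact: cvg_cst|exact: bounded_on0].
move=> [cf bf] [cg bg]; split; last exact: bounded_onZD.
by move=> x; apply: cvgD; [apply: cvgZl_tmp; exact: cf|exact: cg].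
Qed.

HB.instance Definition _ := GRing.isSubmodClosed.Build R[i] (X -> B)
  bounded_continuous bounded_continuous_submod_closed.

Record bcont := BCont { bcont_val :> X -> B; bcontP : bcont_val \in bounded_continuous }.

HB.instance Definition _ := [isSub for bcont_val].
HB.instance Definition _ := [Choice of bcont by <:].
HB.instance Definition _ := [SubChoice_isSubLmodule of bcont by <:].

Lemma bcont_bounded (f : bcont) : bounded_on setT f.
Proof. by have := bcontP f; rewrite inE => -[]. Qed.

Definition bcont_norm (f : bcont) : R[i] := (sup_norm setT f)%:C.

Lemma bcont_normD f g : bcont_norm (f + g) <= bcont_norm f + bcont_norm g.
Proof. by rewrite -rmorphD/= lecR; apply: sup_normD; exact: bcont_bounded. Qed.

Lemma bcont_normZ (l : R[i]) f : bcont_norm (l *: f) = `|l| * bcont_norm f.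
Proof. by rewrite /bcont_norm (sup_normZ _ (bcont_bounded f)) rmorphM. Qed.

Lemma bcont_norm_eq0 f : bcont_norm f = 0 -> f = 0.
Proof.
move=> /(@complexI _ _ 0) f0; apply/val_inj/funext => x.
exact: (sup_norm_eq0 (bcont_bounded f) f0).
Qed.

HB.instance Definition _ := Lmodule_isNormed.Build R[i] bcont
  bcont_normD bcont_normZ bcont_norm_eq0.

Lemma nrm_bcont (f : bcont) : nrm f = sup_norm setT f.
Proof. by apply: complexI; rewrite -nrmE. Qed.

End bounded_continuous_functions.
Arguments bounded_continuous {R} _ _ _.

Section linf_space.
Context {R : realType}.
Variables (G : Type) (Z : normedModType R[i]).

Definition bounded_family : {pred G -> Z} :=
  mem [set f | bounded_on setT f].

Lemma bounded_family_submod_closed : submod_closed bounded_family.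
Proof.
split=> [|l f g]; rewrite !inE /=; first exact: bounded_on0.
by move=> bf bg; exact: bounded_onZD.
Qed.

HB.instance Definition _ := GRing.isSubmodClosed.Build R[i] (G -> Z)
  bounded_family bounded_family_submod_closed.

Record linf := LInf { linf_val :> G -> Z; linfP : linf_val \in bounded_family }.

HB.instance Definition _ := [isSub for linf_val].
HB.instance Definition _ := [Choice of linf by <:].
HB.instance Definition _ := [SubChoice_isSubLmodule of linf by <:].

Lemma linf_bounded (f : linf) : bounded_on setT f.
Proof. by have := linfP f; rewrite inE. Qed.

Definition linf_norm (f : linf) : R[i] := (sup_norm setT f)%:C.

Lemma linf_normD f g : linf_norm (f + g) <= linf_norm f + linf_norm g.
Proof. by rewrite -rmorphD/= lecR; apply: sup_normD; exact: linf_bounded. Qed.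

Lemma linf_normZ (l : R[i]) f : linf_norm (l *: f) = `|l| * linf_norm f.
Proof. by rewrite /linf_norm (sup_normZ _ (linf_bounded f)) rmorphM. Qed.

Lemma linf_norm_eq0 f : linf_norm f = 0 -> f = 0.
Proof.
move=> /(@complexI _ _ 0) f0; apply/val_inj/funext => x.
exact: (sup_norm_eq0 (linf_bounded f) f0).
Qed.

HB.instance Definition _ := Lmodule_isNormed.Build R[i] linf
  linf_normD linf_normZ linf_norm_eq0.

Lemma nrm_linf (f : linf) : nrm f = sup_norm setT f.
Proof. by apply: complexI; rewrite -nrmE. Qed.

End linf_space.
Arguments bounded_family {R} _ _ _.

Section l0_space.
Context {R : realType}.
Variables (G : choiceType) (Z : normedModType R[i]).

Definition vanishing_family : {pred G -> Z} :=
  mem [set f | forall e : R, 0 < e -> finite_set [set g | e <= nrm (f g)]].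

Lemma vanishing_family_submod_closed : submod_closed vanishing_family.
Proof.
split=> [|l f g]; rewrite !inE /=.
  move=> e e0; rewrite (_ : [set _ | _] = set0)//; apply/seteqP; split=> g //=.
  by rewrite nrm0 leNgt e0.
move=> f0 g0 e e0; pose k := nrm (l : R[i]^o) + 1.
have k0 : 0 < k by rewrite ltr_wpDl ?nrm_ge0.
have e2 : 0 < e / 2 by rewrite divr_gt0.
have ek : 0 < e / 2 / k by rewrite divr_gt0.
apply: (@sub_finite_set _ _
  ([set g | e / 2 / k <= nrm (f g)] `|` [set h | e / 2 <= nrm (g h)])).
  move=> h /= eh; have [|lf] := leP (e / 2 / k) (nrm (f h)); first by left.
  right; rewrite leNgt; apply/negP => lg; move: eh; rewrite leNgt => /negP; apply.
  rewrite (le_lt_trans (nrmD _ _))// (splitr e) ltr_leD// ?nrmZ ?(ltW lg)//.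
  rewrite (@le_lt_trans _ _ (k * nrm (f h)))//.
    by rewrite ler_wpM2r ?nrm_ge0// lerDl.
  by rewrite mulrC -ltr_pdivlMr.
by rewrite finite_setU; split; [exact: f0|exact: g0].
Qed.

HB.instance Definition _ := GRing.isSubmodClosed.Build R[i] (G -> Z)
  vanishing_family vanishing_family_submod_closed.

Record l0 := L0 { l0_val :> G -> Z; l0P : l0_val \in vanishing_family }.

HB.instance Definition _ := [isSub for l0_val].
HB.instance Definition _ := [Choice of l0 by <:].
HB.instance Definition _ := [SubChoice_isSubLmodule of l0 by <:].

Lemma l0_bounded (f : l0) : bounded_on setT f.
Proof. 
have := l0P f; rewrite inE => /(_ 1 ltr01) /finite_seqP[s sE].
exists (1 + \sum_(g <- s) nrm (f g)) => g _.
have [lt1|ge1] := ltP (nrm (f g)) 1.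
  by rewrite (le_trans (ltW lt1))// lerDl sumr_ge0// => *; exact: nrm_ge0.
have gs : g \in s by have : [set` s] g by rewrite -sE.
rewrite (big_rem g)//= addrCA lerDl addr_ge0// sumr_ge0// => *; exact: nrm_ge0.
 Qed.

Definition l0_norm (f : l0) : R[i] := (sup_norm setT f)%:C.

Lemma l0_normD f g : l0_norm (f + g) <= l0_norm f + l0_norm g.
Proof. by rewrite -rmorphD/= lecR; apply: sup_normD; exact: l0_bounded. Qed.

Lemma l0_normZ (l : R[i]) f : l0_norm (l *: f) = `|l| * l0_norm f.
Proof. by rewrite /l0_norm (sup_normZ _ (l0_bounded f)) rmorphM. Qed.

Lemma l0_norm_eq0 f : l0_norm f = 0 -> f = 0.
Proof.
move=> /(@complexI _ _ 0) f0; apply/val_inj/funext => x.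
exact: (sup_norm_eq0 (l0_bounded f) f0).
Qed.

HB.instance Definition _ := Lmodule_isNormed.Build R[i] l0
  l0_normD l0_normZ l0_norm_eq0.

Lemma nrm_l0 (f : l0) : nrm f = sup_norm setT f.
Proof. by apply: complexI; rewrite -nrmE. Qed.

End l0_space.
Arguments vanishing_family {R} _ _ _.

Section strong_measurability.
Context {R : realType} {d : measure_display} {T : measurableType d}.
Variables (mu : {measure set T -> \bar R}) (E : normedModType R[i]).
Implicit Types (f g s : T -> E).

Definition simple_function s :=
  finite_set (range s) /\ forall y, measurable (s @^-1` [set y]).

Definition strongly_measurable f := exists s : nat -> T -> E,
  (forall n, simple_function (s n)) /\
  {ae mu, forall x, s n x @[n --> \oo] --> f x}.

Definition ess_bounded f := exists M : R, {ae mu, forall x, nrm (f x) <= M}.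

Definition Linf_function : {pred T -> E} :=
  mem [set f | strongly_measurable f /\ ess_bounded f].

Definition ess_norm f : R := fine (ess_sup mu (fun x => (nrm (f x))%:E)).

Lemma simple_functionZD (l : R[i]) s s' :
  simple_function s -> simple_function s' -> simple_function (l *: s + s').
Proof.
move=> [fs ms] [fs' ms']; split.
  apply: sub_finite_set (finite_image2 (fun y z => l *: y + z) fs fs').
  by move=> _ [x _ <-]; exists (s x); [exists x|exists (s' x); [exists x|]].
move=> y; rewrite (_ : _ @^-1` _ = \bigcup_(z in range s)
    (s @^-1` [set z] `&` s' @^-1` [set y - l *: z])).
  by apply: fin_bigcup_measurable => // z _; exact: measurableI.
apply/seteqP; split=> [x /= <-|x [z _ [/= <- s'x]]].
  by exists (s x); [exists x|split => //=; rewrite addrC addKr].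
by rewrite !fctE s'x addrC subrK.
Qed.

Lemma strongly_measurableZD (l : R[i]) f g :
  strongly_measurable f -> strongly_measurable g ->
  strongly_measurable (l *: f + g).
Proof.
move=> [s [ss sf]] [s' [ss' sg]]; exists (fun n => l *: s n + s' n); split.
  by move=> n; exact: simple_functionZD.
apply: filterS2 sf sg => x sf sg.
by apply: cvgD => //; exact: cvgZl_tmp.
Qed.

Lemma ess_boundedZD (l : R[i]) f g :
  ess_bounded f -> ess_bounded g -> ess_bounded (l *: f + g).
Proof.
move=> [M fM] [N gN]; exists (nrm (l : R[i]^o) * M + N).
apply: filterS2 fM gN => x fM gN.
rewrite (le_trans (nrmD _ _))// nrmZ lerD//.
by rewrite ler_wpM2l ?nrm_ge0.
Qed.

Lemma Linf_function_submod_closed : submod_closed Linf_function.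
Proof.
split=> [|l f g]; rewrite !inE /=.
  split; last by exists 0; apply: aeW => x; rewrite nrm0.
  exists (fun=> 0); split; last by apply: aeW => x; exact: cvg_cst.
  move=> _; split; last by move=> y; rewrite preimage_cst; case: ifP.
  by apply: sub_finite_set (finite_set1 (0 : E)) => _ [x _ <-].
by move=> [mf bf] [mg bg]; split;
  [exact: strongly_measurableZD|exact: ess_boundedZD].
Qed.

HB.instance Definition _ := GRing.isSubmodClosed.Build R[i] (T -> E)
  Linf_function Linf_function_submod_closed.

Lemma ess_norm_ub f : ess_bounded f -> {ae mu, forall x, nrm (f x) <= ess_norm f}.
Proof.
move=> [M bM].
have fM : (ess_sup mu (fun x => (nrm (f x))%:E) <= M%:E)%E by exact/ess_supP.
have := ess_sup_ge mu (fun x => (nrm (f x))%:E).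
rewrite /ess_norm; move: fM; case: ess_sup => [r _| |_] //.
by apply: filterS.
Qed.

Lemma ess_norm_le f M :
  0 <= M -> {ae mu, forall x, nrm (f x) <= M} -> ess_norm f <= M.
Proof.
move=> M0 bM.
have : (ess_sup mu (fun x => (nrm (f x))%:E) <= M%:E)%E by exact/ess_supP.
by rewrite /ess_norm; case: ess_sup.
Qed.

Lemma ess_norm_ge0 f : ess_bounded f -> 0 <= ess_norm f.
Proof.
move=> bf; have := ess_norm_ub bf; rewrite leNgt => fle; apply/negP => lt0.
have: ess_sup mu (fun x => (nrm (f x))%:E) = -oo%E.
  apply/ess_sup_eqNyP; apply: filterS fle => x /le_lt_trans /(_ lt0).
  by rewrite ltNge nrm_ge0.
by move=> supN; move: lt0; rewrite /ess_norm supN ltxx.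
Qed.

End strong_measurability.
Arguments Linf_function {R d T} mu E _.

Section Linf_space.
Context {R : realType} {d : measure_display} {T : measurableType d}.
Variables (mu : {measure set T -> \bar R}) (E : normedModType R[i]).

Record Linf_fun :=
  LinfFun { Linf_fun_val :> T -> E; Linf_funP : Linf_fun_val \in Linf_function mu E }.

HB.instance Definition _ := [isSub for Linf_fun_val].
HB.instance Definition _ := [Choice of Linf_fun by <:].
HB.instance Definition _ := [SubChoice_isSubLmodule of Linf_fun by <:].

Definition null_function : {pred Linf_fun} :=
  mem [set f : Linf_fun | {ae mu, forall x, f x = 0}].

Lemma null_function_zmod_closed : zmod_closed null_function.
Proof.
split=> [|f g]; rewrite !inE /=; first exact: aeW.
by move=> f0 g0; apply: filterS2 f0 g0 => x f0 g0; rewrite !fctE f0 g0 subr0.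
Qed.

HB.instance Definition _ := GRing.isZmodClosed.Build Linf_fun
  null_function null_function_zmod_closed.

Definition Linf := Quotient.quot null_function.

HB.instance Definition _ := GRing.Zmodule.on Linf.
HB.instance Definition _ := EqQuotient.on Linf.

Definition Linf_class (f : Linf_fun) : Linf := (\pi_Linf f)%qT.

Definition Linf_repr (u : Linf) : Linf_fun := repr u.

Coercion Linf_repr : Linf >-> Linf_fun.

Lemma Linf_classP (f g : Linf_fun) :
  Linf_class f = Linf_class g <-> {ae mu, forall x, f x = g x}.
Proof.
rewrite (rwP eqP) /Linf_class -Quotient.idealrBE inE /=.
have subE x : (f - g : Linf_fun) x = f x - g x by [].
split; apply: filterS => x fg; last by rewrite [LHS]subE fg subrr.
by apply/eqP; rewrite -subr_eq0 -subE; exact/eqP.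
Qed.

Lemma Linf_reprK (f : Linf_fun) : {ae mu, forall x, Linf_class f x = f x}.
Proof. by apply/Linf_classP; rewrite /Linf_class reprK. Qed.

End Linf_space.

Section Linf_normed_module.
Context {R : realType} {d : measure_display} {T : measurableType d}.
Variables (mu : {measure set T -> \bar R}) (E : normedModType R[i]).
Local Notation Linf := (Linf mu E).
Implicit Types (f g : Linf_fun mu E) (u v : Linf).

Lemma Linf_classK u : Linf_class (Linf_repr u) = u.
Proof. by rewrite /Linf_class reprK. Qed.

Lemma Linf_classD f g : Linf_class (f + g) = Linf_class f + Linf_class g.
Proof. exact: Quotient.pi_add. Qed.

Definition Linf_scale (l : R[i]) u : Linf := Linf_class (l *: Linf_repr u).

Lemma Linf_classZ (l : R[i]) f :
  Linf_class (l *: f) = Linf_scale l (Linf_class f).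
Proof.
apply/Linf_classP; apply: filterS (Linf_reprK f) => x fx.
by rewrite /= !fctE fx.
Qed.

Lemma Linf_scalerA a b u : Linf_scale a (Linf_scale b u) = Linf_scale (a * b) u.
Proof. by rewrite -[u]Linf_classK -!Linf_classZ scalerA. Qed.

Lemma Linf_scale1r : left_id 1 Linf_scale.
Proof. by move=> u; rewrite -[u in LHS]Linf_classK -Linf_classZ scale1r Linf_classK. Qed.

Lemma Linf_scalerDr : right_distributive Linf_scale +%R.
Proof.
move=> a u v; rewrite -[u]Linf_classK -[v]Linf_classK.
by rewrite -Linf_classD -!Linf_classZ -Linf_classD scalerDr.
Qed.

Lemma Linf_scalerDl u : {morph Linf_scale^~ u : a b / a + b}.
Proof.
move=> a b; rewrite -[u]Linf_classK.
by rewrite -!Linf_classZ -Linf_classD scalerDl.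
Qed.

HB.instance Definition _ := GRing.Zmodule_isLmodule.Build R[i] Linf
  Linf_scalerA Linf_scale1r Linf_scalerDr Linf_scalerDl.

Lemma Linf_class_linear : linear (@Linf_class _ _ _ mu E).
Proof. by move=> a f g; rewrite Linf_classD Linf_classZ. Qed.

HB.instance Definition _ :=
  GRing.isLinear.Build R[i] _ _ _ (@Linf_class _ _ _ mu E) Linf_class_linear.

Lemma Linf_fun_bounded f : ess_bounded mu f.
Proof. by have := Linf_funP f; rewrite inE => -[]. Qed.

Lemma Linf_fun_measurable f : strongly_measurable mu f.
Proof. by have := Linf_funP f; rewrite inE => -[]. Qed.

Definition Linf_norm u : R[i] := (ess_norm mu u)%:C.

Lemma Linf_reprD u v : {ae mu, forall x, (u + v : Linf) x = u x + v x}.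
Proof.
have := Linf_reprK (Linf_repr u + Linf_repr v).
by rewrite Linf_classD !Linf_classK.
Qed.

Lemma Linf_reprZ l u : {ae mu, forall x, (l *: u : Linf) x = l *: u x}.
Proof.
have := Linf_reprK (l *: Linf_repr u).
by rewrite Linf_classZ !Linf_classK.
Qed.

Lemma Linf_normD u v : Linf_norm (u + v) <= Linf_norm u + Linf_norm v.
Proof.
rewrite -rmorphD/= lecR; apply: ess_norm_le.
  by rewrite addr_ge0// ess_norm_ge0//; exact: Linf_fun_bounded.
have bu := ess_norm_ub (Linf_fun_bounded (Linf_repr u)).
have bv := ess_norm_ub (Linf_fun_bounded (Linf_repr v)).
apply: filterS3 (Linf_reprD u v) bu bv => x -> ux vx.
by rewrite (le_trans (nrmD _ _))// lerD.
Qed.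

Lemma Linf_norm_eq0 u : Linf_norm u = 0 -> u = 0.
Proof.
move=> /(@complexI _ _ 0) u0; rewrite -[u]Linf_classK -[RHS]Linf_classK.
apply/Linf_classP; have r0 : {ae mu, forall x, (0 : Linf) x = 0}.
  have := Linf_reprZ 0 0; rewrite scale0r; apply: filterS => x ->.
  by rewrite scale0r.
have := ess_norm_ub (Linf_fun_bounded (Linf_repr u)); rewrite u0 => ux0.
apply: filterS2 r0 ux0 => x -> ux; apply: nrm_eq0.
by apply/le_anti; rewrite ux nrm_ge0.
Qed.

Lemma Linf_normZ l u : Linf_norm (l *: u) = `|l| * Linf_norm u.
Proof.
have le k (w : Linf) : ess_norm mu (k *: w : Linf) <= nrm (k : R[i]^o) * ess_norm mu w.
  apply: ess_norm_le.
    by rewrite mulr_ge0 ?nrm_ge0// ess_norm_ge0//; exact: Linf_fun_bounded.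
  have bw := ess_norm_ub (Linf_fun_bounded (Linf_repr w)).
  apply: filterS2 (Linf_reprZ k w) bw => x -> wx.
  by rewrite nrmZ ler_wpM2l ?nrm_ge0.
have -> : `|l| = (nrm (l : R[i]^o))%:C by rewrite -nrmE.
rewrite /Linf_norm -rmorphM/=; congr (_%:C); apply/le_anti; rewrite le/=.
have [->|l0] := eqVneq l 0.
  by rewrite nrm0 mul0r ess_norm_ge0//; exact: Linf_fun_bounded.
have lgt0 : 0 < nrm (l : R[i]^o).
  by rewrite lt_neqAle nrm_ge0 andbT eq_sym; apply: contra_neq l0; exact: nrm_eq0.
have := le l^-1 (l *: u); rewrite scalerA mulVf// scale1r.
rewrite (_ : nrm (l^-1 : R[i]^o) = (nrm (l : R[i]^o))^-1); last first.
  by apply: complexI; rewrite fmorphV/= -!nrmE normfV.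
by rewrite -ler_pdivlMl// invrK.
Qed.

HB.instance Definition _ := Lmodule_isNormed.Build R[i] Linf
  Linf_normD Linf_normZ Linf_norm_eq0.

Lemma nrm_Linf u : nrm u = ess_norm mu u.
Proof. by apply: complexI; rewrite -nrmE. Qed.

End Linf_normed_module.

(* An operator of [Linf] induced by an operator on functions. *)
Section induced_operator.
Context {R : realType} {d : measure_display} {T : measurableType d}.
Context {mu : {measure set T -> \bar R}} {E : normedModType R[i]}.
Variable Phi : (T -> E) -> T -> E.
Hypothesis Phi_Linf : forall f, f \in Linf_function mu E ->
  Phi f \in Linf_function mu E.
Hypothesis Phi_linear : linear Phi.
Hypothesis Phi_ae : forall f g : T -> E,
  {ae mu, forall x, f x = g x} -> {ae mu, forall x, Phi f x = Phi g x}.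
Hypothesis Phi_bounded : exists2 M : R, 0 <= M & forall f N,
  {ae mu, forall x, nrm (f x) <= N} -> {ae mu, forall x, nrm (Phi f x) <= M * N}.

Definition induced_fun (u : Linf mu E) : Linf mu E :=
  Linf_class (LinfFun (Phi_Linf (Linf_funP (Linf_repr u)))).

Lemma induced_linear : linear induced_fun.
Proof.
move=> a u v; rewrite /induced_fun -linearP; apply/Linf_classP.
have h : {ae mu, forall x, (a *: u + v : Linf mu E) x = (a *: (Linf_repr u : T -> E) + (Linf_repr v : T -> E)) x}.
  apply: filterS2 (Linf_reprD (a *: u) v) (Linf_reprZ a u) => x -> ->.
  by rewrite !fctE.
by apply: filterS (Phi_ae h) => x /= ->; rewrite Phi_linear.
Qed.

Lemma induced_bounded : exists M : R, forall u, nrm (induced_fun u) <= M * nrm u.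
Proof.
have [M M0 PhiM] := Phi_bounded; exists M => u.
have bu := ess_norm_ub (Linf_fun_bounded (Linf_repr u)).
rewrite !nrm_Linf; apply: ess_norm_le.
  by rewrite mulr_ge0// ess_norm_ge0//; exact: Linf_fun_bounded.
have Pu := PhiM _ _ bu.
have ru := Linf_reprK (LinfFun (Phi_Linf (Linf_funP (Linf_repr u)))).
by apply: filterS2 ru Pu => x ->.
Qed.

Definition induced_op : 'L(Linf mu E) :=
  mk_bop induced_fun induced_linear induced_bounded.

Lemma induced_opE (u : Linf mu E) : {ae mu, forall x, (induced_op u : Linf mu E) x = Phi u x}.
Proof. exact: Linf_reprK. Qed.

End induced_operator.

Notation borel X := (g_sigma_algebraType (@open X)).

Section dynamical_system.
Context {R : realType} {X : ptopologicalType} {G : groupType}.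
Variables (mu : {measure set (borel X) -> \bar R}) (t : G -> X -> X).

Definition measure_support : set X :=
  [set x | forall U : set X, open U -> U x -> (0 < mu U)%E].

Definition homeomorphism (f : X -> X) :=
  continuous f /\ exists h, [/\ continuous h, cancel f h & cancel h f].

Definition homeomorphism_group :=
  (forall g, homeomorphism (t g)) /\
  (forall g h x, t (g * h)%g x = t g (t h x)).

Definition preserves_class :=
  forall g, pushforward mu (t g : borel X -> borel X) `<< mu.

Definition topologically_free :=
  forall g, g != 1%g -> interior [set x | t g x = x] = set0.

Hypothesis t_homeo : homeomorphism_group.

Lemma homeomorphism_group1 x : t 1%g x = x.
Proof.
have [th tM] := t_homeo; have [_ [h [_ tK _]]] := th 1%g.
by apply: (can_inj tK); rewrite -tM mulg1.
Qed.

Lemma homeomorphism_group_continuous g : continuous (t g).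
Proof. by have [+ _] := t_homeo => /(_ g) []. Qed.

Lemma homeomorphism_group_measurable g :
  measurable_fun setT (t g : borel X -> borel X).
Proof.
apply: (@measurability _ _ (borel X) (borel X) setT (t g) (@open X)) => //.
move=> _ [U oU <-]; rewrite setTI; apply: sub_sigma_algebra; move: oU; apply: open_comp => x _.
exact: homeomorphism_group_continuous.
Qed.

Hypothesis t_mu : preserves_class.

Lemma ae_translate g (P : borel X -> Prop) :
  {ae mu, forall x, P x} -> {ae mu, forall x : borel X, P (t g x)}.
Proof.
move=> [N [mN N0 PN]]; exists (t g @^-1` N); split=> [| |x /= /PN//].
  by rewrite -[X in measurable X]setTI; exact: homeomorphism_group_measurable.
by have /null_content_dominatesP := t_mu g; exact.
Qed.

End dynamical_system.

Section covariant_operators.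
Context {R : realType} {X : ptopologicalType} {G : groupType}.
Context {mu : {measure set (borel X) -> \bar R}} {E : normedModType R[i]}.

(* The inclusion of [C(X, L(E))] in [L(D)] presupposes that [a f] belongs to
   [D] for all [a] and [f]; boundedness is clear, so that strong measurability is the
   only issue. It is automatic when [mu] is sigma-finite of full support, see
   [sigma_finite_acts_by_multiplication] below, but not in general: take [E]
   infinite-dimensional and [mu] the counting measure of an uncountable
   discrete space. *)
Definition acts_by_multiplication :=
  forall (a : bcont X 'L(E)) (f : borel X -> E), f \in Linf_function mu E ->
  strongly_measurable mu (fun x => a x (f x)).

Section multiplication.
Hypothesis acts : acts_by_multiplication.
Variable a : bcont X 'L(E).

Let Phi (f : borel X -> E) (x : borel X) := a x (f x).

Lemma multiplication_le f (N : R) :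
  {ae mu, forall x, nrm (f x) <= N} -> {ae mu, forall x, nrm (Phi f x) <= nrm a * N}.
Proof.
apply: filterS => x fx; rewrite (le_trans (bop_le _ _))//.
rewrite (@le_trans _ _ (nrm a * nrm (f x)))//; last first.
  by rewrite ler_wpM2l ?nrm_ge0.
by rewrite ler_wpM2r ?nrm_ge0// nrm_bcont sup_norm_ub//; exact: bcont_bounded.
Qed.

Lemma multiplication_Linf f : f \in Linf_function mu E ->
  Phi f \in Linf_function mu E.
Proof.
move=> Lf; rewrite inE; split; first exact: acts.
move: Lf; rewrite inE => -[_ [N fN]].
by exists (nrm a * N); exact: multiplication_le.
Qed.

Lemma multiplication_linear : linear Phi.
Proof. by move=> l f g; apply/funext => x; rewrite /Phi !fctE linearP. Qed.

Lemma multiplication_ae (f g : borel X -> E) :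
  {ae mu, forall x, f x = g x} -> {ae mu, forall x, Phi f x = Phi g x}.
Proof. by apply: filterS => x; rewrite /Phi => ->. Qed.

Lemma multiplication_bounded : exists2 M : R, 0 <= M & forall f N,
  {ae mu, forall x, nrm (f x) <= N} -> {ae mu, forall x, nrm (Phi f x) <= M * N}.
Proof. by exists (nrm a); [exact: nrm_ge0|exact: multiplication_le]. Qed.

Definition mult_op : 'L(Linf mu E) :=
  induced_op multiplication_Linf multiplication_linear multiplication_ae
    multiplication_bounded.

End multiplication.

Section translation.
Variable t : G -> X -> X.
Hypothesis t_homeo : homeomorphism_group t.
Hypothesis t_mu : preserves_class mu t.
Variable g : G.

Let Phi (f : borel X -> E) (x : borel X) := f (t g^-1%g x).

Lemma translation_Linf f : f \in Linf_function mu E ->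
  Phi f \in Linf_function mu E.
Proof.
rewrite !inE => -[[s [ss sf]] [N fN]]; split; last first.
  by exists N; exact: (ae_translate t_homeo t_mu g^-1%g fN).
exists (fun n => Phi (s n)); split; last first.
  exact: (ae_translate t_homeo t_mu g^-1%g sf).
move=> n; have [fin_s ms] := ss n; split.
  by apply: sub_finite_set fin_s => _ [x _ <-]; exists (t g^-1%g x).
move=> y; rewrite -[X in measurable X]setTI.
exact: (homeomorphism_group_measurable t_homeo g^-1%g measurableT (ms y)).
Qed.

Lemma translation_linear : linear Phi.
Proof. by []. Qed.

Lemma translation_ae (f h : borel X -> E) :
  {ae mu, forall x, f x = h x} -> {ae mu, forall x, Phi f x = Phi h x}.
Proof. by move=> fh; exact: (ae_translate t_homeo t_mu g^-1%g fh). Qed.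

Lemma translation_bounded : exists2 M : R, 0 <= M & forall f N,
  {ae mu, forall x, nrm (f x) <= N} -> {ae mu, forall x, nrm (Phi f x) <= M * N}.
Proof.
exists 1 => // f N fN; rewrite mul1r.
exact: (ae_translate t_homeo t_mu g^-1%g fN).
Qed.

(* [(T_g f)(x) = f(t_g^-1(x))]; note that [t_g^-1] is [t] at the inverse of [g] *)
Definition translation_op : 'L(Linf mu E) :=
  induced_op translation_Linf translation_linear translation_ae
    translation_bounded.

Lemma translation_op_le (u : Linf mu E) : nrm (translation_op u) <= nrm u.
Proof.
have bu := ess_norm_ub (Linf_fun_bounded (Linf_repr u)).
rewrite !nrm_Linf; apply: ess_norm_le.
  by rewrite ess_norm_ge0//; exact: Linf_fun_bounded.
have tu := ae_translate t_homeo t_mu g^-1%g bu.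
have Tu : {ae mu, forall x, (translation_op u : Linf mu E) x = Phi (Linf_repr u) x}.
  exact: induced_opE.
by apply: filterS2 Tu tu => x ->.
Qed.

End translation.

Lemma translation_op_contraction (t : G -> X -> X)
    (t_homeo : homeomorphism_group t) (t_mu : preserves_class mu t) g :
  nrm (translation_op t_homeo t_mu g) <= 1.
Proof.
by apply: bop_nrm_le => // u; rewrite mul1r; exact: translation_op_le.
Qed.

End covariant_operators.
Arguments acts_by_multiplication {R X} mu E.

Section regular_representation.
Context {R : realType} {G : groupType} {Z : normedModType R[i]} {A : Type}.
Variables (M : A -> 'L(Z)) (T : G -> 'L(Z)).

(* [T_g^-1] is [T] at the inverse of [g] *)
Definition conj_op g a : 'L(Z) := T g ∘ M a ∘ T g^-1%g.

Hypothesis T_contraction : forall g, nrm (T g) <= 1.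

Lemma conj_op_le g a z : nrm (conj_op g a z) <= nrm (M a) * nrm z.
Proof.
have Tle h y : nrm (T h y) <= nrm y.
  rewrite (le_trans (bop_le _ _))// -[leRHS]mul1r.
  by rewrite ler_wpM2r ?nrm_ge0.
rewrite (le_trans (Tle _ _))//= (le_trans (bop_le _ _))//.
by rewrite ler_wpM2l ?nrm_ge0.
Qed.

Section in_linf.
Local Notation H := (linf G Z).

Lemma shift_linf_subproof (g0 : G) (xi : H) :
  (fun g => xi (g * g0)%g) \in bounded_family G Z.
Proof.
have [N xiN] := linf_bounded xi.
by rewrite inE; exists N => g _; exact: xiN.
Qed.

Definition shift_linf_fun (g0 : G) (xi : H) : H := LInf (shift_linf_subproof g0 xi).

Lemma shift_linf_linear g0 : linear (shift_linf_fun g0).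
Proof. by move=> a x y; exact/val_inj. Qed.

Lemma shift_linf_bounded g0 :
  exists N : R, forall xi, nrm (shift_linf_fun g0 xi) <= N * nrm xi.
Proof.
exists 1 => xi; rewrite mul1r !nrm_linf; apply: sup_norm_le => [|g _].
  by rewrite sup_norm_ge0//; exact: linf_bounded.
by rewrite (sup_norm_ub (linf_bounded xi)).
Qed.

Definition shift_linf (g0 : G) : 'L(H) :=
  mk_bop (shift_linf_fun g0) (shift_linf_linear g0) (shift_linf_bounded g0).

Lemma diag_linf_subproof a (xi : H) :
  (fun g => conj_op g a (xi g)) \in bounded_family G Z.
Proof.
have [N xiN] := linf_bounded xi.
rewrite inE; exists (nrm (M a) * N) => g _; rewrite (le_trans (conj_op_le _ _ _))//.
by rewrite ler_wpM2l ?nrm_ge0 ?xiN.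
Qed.

Definition diag_linf_fun a (xi : H) : H := LInf (diag_linf_subproof a xi).

Lemma diag_linf_linear a : linear (diag_linf_fun a).
Proof. by move=> l x y; apply/val_inj/funext => g; exact: (linearP (conj_op g a)). Qed.

Lemma diag_linf_bounded a :
  exists N : R, forall xi, nrm (diag_linf_fun a xi) <= N * nrm xi.
Proof.
exists (nrm (M a)) => xi; rewrite !nrm_linf; apply: sup_norm_le => [|g _].
  by rewrite mulr_ge0 ?nrm_ge0// sup_norm_ge0//; exact: linf_bounded.
rewrite (le_trans (conj_op_le _ _ _))// ler_wpM2l ?nrm_ge0//.
by rewrite (sup_norm_ub (linf_bounded xi)).
Qed.

Definition diag_linf a : 'L(H) :=
  mk_bop (diag_linf_fun a) (diag_linf_linear a) (diag_linf_bounded a).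

End in_linf.

Section in_l0.
Local Notation H := (l0 G Z).

Lemma shift_l0_subproof (g0 : G) (xi : H) :
  (fun g => xi (g * g0)%g) \in vanishing_family G Z.
Proof.
rewrite inE => e e0; have := l0P xi; rewrite inE => /(_ e e0) fin.
apply: sub_finite_set (finite_image (fun g => (g * g0^-1)%g) fin) => g /= eg.
by exists (g * g0)%g => //; rewrite mulgK.
Qed.

Definition shift_l0_fun (g0 : G) (xi : H) : H := L0 (shift_l0_subproof g0 xi).

Lemma shift_l0_linear g0 : linear (shift_l0_fun g0).
Proof. by move=> a x y; exact/val_inj. Qed.

Lemma shift_l0_bounded g0 :
  exists N : R, forall xi, nrm (shift_l0_fun g0 xi) <= N * nrm xi.
Proof.
exists 1 => xi; rewrite mul1r !nrm_l0; apply: sup_norm_le => [|g _].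
  by rewrite sup_norm_ge0//; exact: l0_bounded.
by rewrite (sup_norm_ub (l0_bounded xi)).
Qed.

Definition shift_l0 (g0 : G) : 'L(H) :=
  mk_bop (shift_l0_fun g0) (shift_l0_linear g0) (shift_l0_bounded g0).

Lemma diag_l0_subproof a (xi : H) :
  (fun g => conj_op g a (xi g)) \in vanishing_family G Z.
Proof.
rewrite inE => e e0; have k0 : 0 < nrm (M a) + 1 by rewrite ltr_wpDl ?nrm_ge0.
have ek : 0 < e / (nrm (M a) + 1) by rewrite divr_gt0.
have := l0P xi; rewrite inE => /(_ _ ek); apply: sub_finite_set => g /= eg.
rewrite ler_pdivrMr// mulrC (le_trans eg)// (le_trans (conj_op_le _ _ _))//.
by rewrite ler_wpM2r ?nrm_ge0// lerDl.
Qed.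

Definition diag_l0_fun a (xi : H) : H := L0 (diag_l0_subproof a xi).

Lemma diag_l0_linear a : linear (diag_l0_fun a).
Proof. by move=> l x y; apply/val_inj/funext => g; exact: (linearP (conj_op g a)). Qed.

Lemma diag_l0_bounded a :
  exists N : R, forall xi, nrm (diag_l0_fun a xi) <= N * nrm xi.
Proof.
exists (nrm (M a)) => xi; rewrite !nrm_l0; apply: sup_norm_le => [|g _].
  by rewrite mulr_ge0 ?nrm_ge0// sup_norm_ge0//; exact: l0_bounded.
rewrite (le_trans (conj_op_le _ _ _))// ler_wpM2l ?nrm_ge0//.
by rewrite (sup_norm_ub (l0_bounded xi)).
Qed.

Definition diag_l0 a : 'L(H) :=
  mk_bop (diag_l0_fun a) (diag_l0_linear a) (diag_l0_bounded a).

End in_l0.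
End regular_representation.

Section generated_algebra.
Context {R : realType} {G : groupType} {Z : normedModType R[i]}.

Section algebra.
Context {A : Type}.
Variables (M : A -> 'L(Z)) (T : G -> 'L(Z)).

Definition finite_sum (F : {fset G}) (a : G -> A) : 'L(Z) :=
  \sum_(g <- F) (M (a g) ∘ T g).

Definition crossed_algebra : set 'L(Z) :=
  closure [set b | exists F a, b = finite_sum F a].

End algebra.

Section properties.
Context {A : normedModType R[i]}.
Variables (M : A -> 'L(Z)) (T : G -> 'L(Z)).

(* If [e] is not in [F], then [a_e = 0] and the inequality is trivial. *)
Definition property_star := forall (F : {fset G}) (a : G -> A),
  1%g \in F -> `|a 1%g| <= `|finite_sum M T F a|.

Definition coefficient_map (g0 : G) (N : 'L(Z) -> A) :=
  {within crossed_algebra M T, continuous N} /\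
  forall (F : {fset G}) (a : G -> A),
    N (finite_sum M T F a) = if g0 \in F then a g0 else 0.

Definition property_starstar := property_star /\
  exists2 N : G -> 'L(Z) -> A, (forall g, coefficient_map g (N g)) &
    forall b, crossed_algebra M T b -> (b = 0 <-> forall g, N g b = 0).

End properties.
End generated_algebra.

Definition character {R : realType} {G : groupType} (chi : G -> R[i]) :=
  (forall g, `|chi g| = 1) /\ forall g h, chi (g * h)%g = chi g * chi h.

Section isomorphism.
Context {R : realType} {Z1 Z2 : normedModType R[i]}.

Definition isometric_isomorphism (B1 : set 'L(Z1)) (B2 : set 'L(Z2))
    (Psi : 'L(Z1) -> 'L(Z2)) :=
  [/\ set_bij B1 B2 Psi,
      forall b, B1 b -> `|Psi b| = `|b|,
      forall (l : R[i]) b c, B1 b -> B1 c -> Psi (l *: b + c) = l *: Psi b + Psi c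
    & forall b c, B1 b -> B1 c -> Psi (b ∘ c) = Psi b ∘ Psi c].

(* [B(A1, T1)] and [B(A2, T2)] are isometrically isomorphic through a map sending
   [M1 a] to [M2 a] and [T1 g] to [T2 g]. *)
Definition canonically_isomorphic {G : groupType} {A : Type}
    (M1 : A -> 'L(Z1)) (T1 : G -> 'L(Z1)) (M2 : A -> 'L(Z2)) (T2 : G -> 'L(Z2)) :=
  exists Psi, [/\ isometric_isomorphism
      (crossed_algebra M1 T1) (crossed_algebra M2 T2) Psi,
    forall a, Psi (M1 a) = M2 a & forall g, Psi (T1 g) = T2 g].

End isomorphism.

(* Main.v *)
Require Import Defs.
From HB Require Import structures.
From mathcomp Require Import all_boot all_order all_algebra finmap.
From mathcomp Require Import complex.
From mathcomp Require Import all_classical all_reals all_analysis ess_sup_inf.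
From mathcomp Require Import lra.
Set Implicit Arguments.
Unset Strict Implicit.
Unset Printing Implicit Defensive.
Import Order.TTheory GRing.Theory Num.Theory.
Import numFieldNormedType.Exports.
Local Open Scope classical_set_scope.
Local Open Scope ring_scope.
Local Open Scope complex_scope.

(** Fix a finite sum [b = sum_h a_h T_h] and put [K = sup_x |L_x|], where
    [L_x : E^F -> E] maps [(e_h)_h] to [sum_h a_h(x) e_h] and [E^F] carries the sup norm.
    Pointwise almost everywhere estimates give [|b| <= K], and the same bound for the image
    of [b] in either regular representation.  In the regular representation [K] is attained
    on families of constant functions, because [mu] has full support.  For [b] itself
    the action is topologically free: every nonempty open set contains a nonempty open [V]
    such that the sets [t_h^-1(V)], [h] in [F], are disjoint, and [b] is tested on the step
    function equal to [e_h] on [t_h^-1(V)].  Hence all the norms are equal to [K], which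
    dominates the norm of every coefficient and does not change when the [a_h] are multiplied
    by unimodular constants.  All operator spaces involved are complete, so the
    correspondence of finite sums extends to the closures; there the regular representation on
    [l_0] shows that an element is determined by its coefficients. *)

(** * Complex norms with real values *)

Section norm.
Context {R : realType} {V : normedModType R[i]}.
Implicit Types (x y : V) (S : set V).

Lemma nrmN x : nrm (- x) = nrm x.
Proof. by rewrite /nrm normrN. Qed.

Lemma nrm_distC x y : nrm (x - y) = nrm (y - x).
Proof. by rewrite /nrm distrC. Qed.

Lemma nrm_dist_triangle z x y : nrm (x - y) <= nrm (x - z) + nrm (z - y).
Proof. by rewrite -[in leLHS](subrKA z) nrmD. Qed.

Lemma nrm_le_add_dist x y : nrm x <= nrm y + nrm (x - y).
Proof. by rewrite -[in leLHS](subrK y x) addrC nrmD. Qed.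

(** In the order of [R[i]] comparable elements differ by a real number, so complex radii of balls
    can be traded for real ones. *)
Lemma complex_gt0 (e : R[i]) : 0 < e -> exists2 d : R, 0 < d & e = d%:C.
Proof.
move=> e0; exists (complex.Re e); last by rewrite RRe_real// gtr0_real.
by rewrite -ltcR RRe_real// gtr0_real.
Qed.

Lemma nbhs_nrmP x S : nbhs x S <-> exists2 e : R, 0 < e & forall y, nrm (x - y) < e -> S y.
Proof.
split.
  move=> /nbhs_ballP[_/posnumP[e] xS].
  have [d d0 ed] := complex_gt0 (gt0 e); exists d => // y xy.
  by apply: xS; rewrite -ball_normE /ball_ /= ed nrmE ltcR.
move=> [e e0 xS]; apply/nbhs_ballP; exists e%:C; first by rewrite /= ltcR.
move=> y; rewrite -ball_normE /ball_ /= nrmE ltcR; exact: xS.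
Qed.

Lemma cvg_nrmP (T : Type) (F : set_system T) {FF : Filter F} (f : T -> V) x :
  f @ F --> x <-> forall e : R, 0 < e -> \forall t \near F, nrm (x - f t) < e.
Proof.
split=> [fx e e0|fx S /nbhs_nrmP[e e0 xS]].
  by have /fx : nbhs x [set y | nrm (x - y) < e] by apply/nbhs_nrmP; exists e.
by apply: filterS (fx e e0) => t /xS.
Qed.

Lemma closure_nrmP S x :
  closure S x <-> forall e : R, 0 < e -> exists2 y, S y & nrm (x - y) < e.
Proof.
split=> [xS e e0|xS B /nbhs_nrmP[e e0 xB]].
  have /xS[y []] : nbhs x [set y | nrm (x - y) < e] by apply/nbhs_nrmP; exists e.
  by exists y.
by have [y Sy xy] := xS e e0; exists y; split=> //; exact: xB.
Qed.

Lemma nrm_sub_le_small x y : (forall e : R, 0 < e -> nrm (x - y) <= e) -> x = y.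
Proof.
move=> xy; apply/eqP; rewrite -subr_eq0; apply/eqP/nrm_eq0/le_anti.
by rewrite nrm_ge0 andbT; apply/ler_addgt0Pr => e e0; rewrite add0r xy.
Qed.

End norm.

(** * Completeness of the function and operator spaces *)

Section sequential_completeness.
Context {R : realType}.

(** Sequences with geometric increments suffice for every limit taken below. The rate depends on [C]
    only, so limits taken point by point inherit it uniformly, and the property passes from a target
    space to spaces of functions and operators. *)
Definition geometrically_complete (V : normedModType R[i]) :=
  forall (u : nat -> V) (C : R),
    (forall n, nrm (u n.+1 - u n) <= C * 2^-1 ^+ n) ->
    exists l, forall n, nrm (u n - l) <= 2 * C * 2^-1 ^+ n.

(** The right side is twice [C] times a telescoping difference, that is, the exact sum of the
    increment bounds from [n] to [m]; keeping the negative term is what closes the induction. *)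
Lemma geometric_tail (V : normedModType R[i]) (u : nat -> V) (C : R) :
  (forall n, nrm (u n.+1 - u n) <= C * 2^-1 ^+ n) ->
  forall n m, (n <= m)%N ->
  nrm (u m - u n) <= 2 * C * (2^-1 ^+ n - 2^-1 ^+ m).
Proof.
move=> uC n; elim=> [|m IH].
  by rewrite leqn0 => /eqP->; rewrite !subrr nrm0 mulr0.
rewrite leq_eqVlt => /predU1P[->|]; first by rewrite !subrr nrm0 mulr0.
rewrite ltnS => /IH nm; rewrite (le_trans (nrm_dist_triangle (u m) _ _))//.
have := lerD (uC m) nm; rewrite exprS; set p := 2^-1 ^+ m; set q := 2^-1 ^+ n; lra.
Qed.

Lemma geometric_small (C e : R) : 0 < e -> \forall n \near \oo, C * 2^-1 ^+ n < e.
Proof.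
move=> e0; have : (fun n => C * 2^-1 ^+ n) @ \oo --> (0 : R).
  rewrite -(mulr0 C); apply: cvgMl_tmp; apply: cvg_expr.
  by rewrite ger0_norm ?invr_ge0// invf_lt1 ?ltr1n.
by move=> /cvgr0_norm_lt /(_ _ e0); apply: filterS => n; exact: le_lt_trans (ler_norm _).
Qed.

Lemma geometric_ratio_ge0 n : (0 : R) <= 2^-1 ^+ n.
Proof. by rewrite exprn_ge0 ?invr_ge0. Qed.

Lemma geometric_limit_unique (V : normedModType R[i]) (u : nat -> V) (C D : R) l l' :
  (forall n, nrm (u n - l) <= C * 2^-1 ^+ n) ->
  (forall n, nrm (u n - l') <= D * 2^-1 ^+ n) -> l = l'.
Proof.
move=> ul ul'; apply: nrm_sub_le_small => e e0.
have [n _ /(_ n (leqnn n)) ne] := geometric_small (C + D) e0.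
rewrite (le_trans (nrm_dist_triangle (u n) _ _))// nrm_distC.
by rewrite (le_trans (lerD (ul n) (ul' n)))// -mulrDl ltW.
Qed.

Lemma complete_geometrically_complete (V : completeNormedModType R[i]) :
  geometrically_complete V.
Proof.
move=> u C uC; have C0 : 0 <= C.
  by have := uC 0; rewrite expr0 mulr1; apply: le_trans (nrm_ge0 _).
have /cauchy_cvgP/cvg_ex[l /cvg_nrmP ul] : cauchy (u @ \oo).
  apply: cauchy_exP => _/posnumP[e]; have [d d0 ed] := complex_gt0 (gt0 e).
  have [n _ /(_ n (leqnn n)) nd] := geometric_small (2 * C) d0.
  exists (u n), n => // m nm; rewrite -ball_normE /ball_ /= ed nrmE ltcR nrm_distC.
  rewrite (le_lt_trans (geometric_tail uC nm))// (le_lt_trans _ nd)//.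
  by rewrite ler_wpM2l ?mulr_ge0// gerBl geometric_ratio_ge0.
exists l => n; apply/ler_addgt0Pr => e e0.
(* The index [maxn m n] is late enough for the limit and not before [n], so the tail bound applies
   to it. *)
have [m _ mP] := ul e e0; have := mP (maxn m n) (leq_maxl _ _).
rewrite nrm_distC => mle.
rewrite (le_trans (nrm_dist_triangle (u (maxn m n)) _ _))// lerD//; last exact: ltW.
rewrite nrm_distC (le_trans (geometric_tail uC (leq_maxr m n)))//.
by rewrite ler_wpM2l ?mulr_ge0// gerBl geometric_ratio_ge0.
Qed.

End sequential_completeness.

(** Bounded families, vanishing families and bounded continuous functions all have this form. With
    [ev] reading off coordinates, one argument serves both regular representations. *)
Record sup_normed {R : realType} {I : Type} {H Z : normedModType R[i]}
    (ev : H -> I -> Z) : Prop := SupNormed {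
  ev_linear : forall l x y i, ev (l *: x + y) i = l *: ev x i + ev y i;
  nrm_ev_le : forall x i, nrm (ev x i) <= nrm x;
  nrm_le_ev : forall x K, 0 <= K -> (forall i, nrm (ev x i) <= K) -> nrm x <= K }.

Section sup_normed_theory.
Context {R : realType} {I : Type} {H Z : normedModType R[i]}.
Variable ev : H -> I -> Z.
Hypothesis evP : sup_normed ev.

Lemma evB x y i : ev (x - y) i = ev x i - ev y i.
Proof. by rewrite -scaleN1r [x + _]addrC (ev_linear evP) scaleN1r addrC. Qed.

Lemma ev_inj x y : (forall i, ev x i = ev y i) -> x = y.
Proof.
move=> xy; apply/eqP; rewrite -subr_eq0; apply/eqP/nrm_eq0/le_anti.
rewrite nrm_ge0 andbT; apply: (nrm_le_ev evP) => // i.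
by rewrite evB xy subrr nrm0.
Qed.

Lemma ev0 i : ev 0 i = 0.
Proof. by rewrite -(subrr 0) evB subrr. Qed.

Lemma evD x y i : ev (x + y) i = ev x i + ev y i.
Proof. by rewrite -[x in LHS]scale1r (ev_linear evP) scale1r. Qed.

Lemma ev_sum (J : Type) (s : seq J) (f : J -> H) i :
  ev (\sum_(j <- s) f j) i = \sum_(j <- s) ev (f j) i.
Proof. by apply: (big_morph (ev^~ i)) => [x y|]; [exact: evD|exact: ev0]. Qed.

(** The limits of the coordinates are reached at a rate independent of the index, hence uniformly;
    the second hypothesis, closedness under uniform limits, brings the limit back into [H]. *)
Lemma sup_normed_complete : geometrically_complete Z ->
  (forall f : I -> Z,
     (forall e : R, 0 < e -> exists x, forall i, nrm (ev x i - f i) <= e) ->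
     exists x, ev x =1 f) ->
  geometrically_complete H.
Proof.
move=> Zc Hcl u C uC; have C0 : 0 <= C.
  by have := uC 0; rewrite expr0 mulr1; apply: le_trans (nrm_ge0 _).
have /choice[f fP] i : exists l, forall n, nrm (ev (u n) i - l) <= 2 * C * 2^-1 ^+ n.
  apply: Zc => n; rewrite -evB; exact: le_trans (nrm_ev_le evP _ _) (uC n).
have [l lf] : exists l, ev l =1 f.
  apply: Hcl => e e0; have [n _ /(_ n (leqnn n)) ne] := geometric_small (2 * C) e0.
  by exists (u n) => i; exact: le_trans (fP i n) (ltW ne).
exists l => n; apply: (nrm_le_ev evP) => [|i].
  by rewrite !mulr_ge0// geometric_ratio_ge0.
by rewrite evB lf.
Qed.

End sup_normed_theory.

Section sup_normed_instances.
Context {R : realType}.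

Lemma linf_sup_normed (G : Type) (Z : normedModType R[i]) :
  sup_normed (fun (x : linf G Z) (g : G) => x g).
Proof.
split=> // x; first by move=> g; rewrite nrm_linf sup_norm_ub//; exact: linf_bounded.
by move=> K K0 xK; rewrite nrm_linf; apply: sup_norm_le.
Qed.

Lemma l0_sup_normed (G : choiceType) (Z : normedModType R[i]) :
  sup_normed (fun (x : l0 G Z) (g : G) => x g).
Proof.
split=> // x; first by move=> g; rewrite nrm_l0 sup_norm_ub//; exact: l0_bounded.
by move=> K K0 xK; rewrite nrm_l0; apply: sup_norm_le.
Qed.

Lemma bcont_sup_normed (X : topologicalType) (B : normedModType R[i]) :
  sup_normed (fun (a : bcont X B) (x : X) => a x).
Proof.
split=> // x; first by move=> g; rewrite nrm_bcont sup_norm_ub//; exact: bcont_bounded.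
by move=> K K0 xK; rewrite nrm_bcont; apply: sup_norm_le.
Qed.

Lemma linf_complete (G : Type) (Z : normedModType R[i]) :
  geometrically_complete Z -> geometrically_complete (linf G Z).
Proof.
move=> Zc; apply: (sup_normed_complete (@linf_sup_normed G Z) Zc) => f fP.
have fb : f \in bounded_family G Z.
  have [x xf] := fP 1 ltr01; rewrite inE; exists (nrm x + 1) => g _.
  rewrite (le_trans (nrm_le_add_dist _ (x g)))// nrm_distC lerD//.
  exact: (nrm_ev_le (@linf_sup_normed G Z)).
by exists (LInf fb).
Qed.

Lemma l0_complete (G : choiceType) (Z : normedModType R[i]) :
  geometrically_complete Z -> geometrically_complete (l0 G Z).
Proof.
move=> Zc; apply: (sup_normed_complete (@l0_sup_normed G Z) Zc) => f fP.
have fv : f \in vanishing_family G Z.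
  (* Where [f] has norm at least [e], an approximant within [e / 2] has norm at least [e / 2], and
     this happens finitely often. *)
  rewrite inE => e e0; have e2 : 0 < e / 2 by rewrite divr_gt0.
  have [x xf] := fP _ e2; have := l0P x; rewrite inE => /(_ _ e2).
  apply: sub_finite_set => g /= eg.
  have := nrm_le_add_dist (f g) (x g); rewrite nrm_distC; have := xf g; lra.
by exists (L0 fv).
Qed.

Lemma continuous_nrmP (X : topologicalType) (B : normedModType R[i]) (f : X -> B) :
  continuous f <-> forall x (e : R), 0 < e -> \forall y \near x, nrm (f x - f y) < e.
Proof.
by split=> [fc x|fc x]; [apply/cvg_nrmP; exact: fc|apply/cvg_nrmP; exact: fc].
Qed.

Lemma bcont_nrmP (X : topologicalType) (B : normedModType R[i]) (a : bcont X B) x (e : R) :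
  0 < e -> \forall y \near x, nrm (a x - a y) < e.
Proof. by have := bcontP a; rewrite inE => -[/continuous_nrmP + _]; exact. Qed.

Lemma bcont_complete (X : topologicalType) (B : normedModType R[i]) :
  geometrically_complete B -> geometrically_complete (bcont X B).
Proof.
move=> Bc; apply: (sup_normed_complete (@bcont_sup_normed X B) Bc) => f fP.
have fb : f \in bounded_continuous X B.
  rewrite inE; split.
    apply/continuous_nrmP => x e e0; have e3 : 0 < e / 3 by rewrite divr_gt0.
    have [a af] := fP _ e3; apply: filterS (bcont_nrmP a x e3) => y.
    have := nrm_dist_triangle (a x) (f x) (f y).
    have := nrm_dist_triangle (a y) (a x) (f y).
    by have := af x; have := af y; rewrite [nrm (a x - f x)]nrm_distC; lra.
  have [x xf] := fP 1 ltr01; exists (nrm x + 1) => g _.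
  rewrite (le_trans (nrm_le_add_dist _ (x g)))// nrm_distC lerD//.
  exact: (nrm_ev_le (@bcont_sup_normed X B)).
by exists (BCont fb).
Qed.

Lemma bop_complete (V W : normedModType R[i]) :
  geometrically_complete W -> geometrically_complete (bop V W).
Proof.
move=> Wc u C uC; have C0 : 0 <= C.
  by have := uC 0; rewrite expr0 mulr1; apply: le_trans (nrm_ge0 _).
(* The pointwise rate is proportional to [nrm x], so it turns into a rate in operator norm. *)
have /choice[f fP] x : exists l, forall n, nrm (u n x - l) <= 2 * (C * nrm x) * 2^-1 ^+ n.
  apply: Wc => n; rewrite mulrAC.
  by rewrite (le_trans (bop_le (u n.+1 - u n) x))// ler_wpM2r ?nrm_ge0.
have fl : linear f.
  move=> a x y.
  (* Linearity holds because both sides are limits of the same sequence at a geometric rate. *)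
  apply: (@geometric_limit_unique _ _ (fun n => u n (a *: x + y))) => [n|n].
    exact: fP.
  rewrite linearP opprD addrACA -scalerBr (le_trans (nrmD _ _))// nrmZ.
  apply: le_trans (lerD (ler_wpM2l (nrm_ge0 _) (fP x n)) (fP y n)) _.
  by rewrite [nrm (a : R[i]^o) * (_ * _ ^+ n)]mulrA -mulrDl.
have fb : exists M : R, forall x, nrm (f x) <= M * nrm x.
  exists (nrm (u 0) + 2 * C) => x; rewrite (le_trans (nrm_le_add_dist _ (u 0 x)))//.
  rewrite mulrDl lerD ?bop_le// nrm_distC.
  by have := fP x 0; rewrite expr0 mulr1 mulrA.
exists (mk_bop f fl fb) => n; apply: bop_nrm_le => [|x].
  by rewrite !mulr_ge0// geometric_ratio_ge0.
by have := fP x n; rewrite mulrA mulrAC.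
Qed.

End sup_normed_instances.

(** * Completeness of L^oo for vector-valued functions *)

Section Linf_completeness.
Context {R : realType} {d : measure_display} {T : measurableType d}.
Variables (mu : {measure set T -> \bar R}) (E : normedModType R[i]).
Implicit Types (f g s : T -> E).

Lemma simple_function_comp (h : E -> E) s :
  simple_function s -> simple_function (h \o s).
Proof.
move=> [fs ms]; split.
  by apply: sub_finite_set (finite_image h fs) => _ [x _ <-]; exists (s x) => //; exists x.
move=> y; rewrite (_ : _ @^-1` _ =
    \bigcup_(z in range s `&` h @^-1` [set y]) (s @^-1` [set z])).
  by apply: fin_bigcup_measurable => //; exact: finite_setIl.
apply/seteqP; split=> [x /= hx|x [z [_ hz] /= sx]]; last by rewrite /= sx.
by exists (s x) => //; split=> //; exists x.
Qed.

Lemma simple_function_sum (I : Type) (r : seq I) (s : I -> T -> E) :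
  (forall i, simple_function (s i)) -> simple_function (\sum_(i <- r) s i).
Proof.
move=> ss; elim: r => [|i r IH]; last first.
  by rewrite big_cons -[s i]scale1r; exact: simple_functionZD.
rewrite big_nil; split; last by move=> y; rewrite preimage_cst; case: ifP.
by apply: sub_finite_set (finite_set1 (0 : E)) => _ [x _ <-].
Qed.

(* Truncating the simple functions converging to the increments
   [f_ n.+1 - f_ n] at twice the bound of these increments makes the series of
   truncations converge uniformly in the diagonal index. *)
Lemma strongly_measurable_geometric_limit (f_ : nat -> T -> E) f (C : R) : 0 < C ->
  (forall n, strongly_measurable mu (f_ n)) ->
  {ae mu, forall x, forall n, nrm (f_ n.+1 x - f_ n x) <= C * 2^-1 ^+ n} ->
  {ae mu, forall x, forall n, nrm (f_ n x - f x) <= 2 * C * 2^-1 ^+ n} ->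
  strongly_measurable mu f.
Proof.
move=> C0 mf df ff; have [s0 [ss0 s0f]] := mf 0.
have /choice[t tP] n : exists t : nat -> T -> E, (forall k, simple_function (t k)) /\
    {ae mu, forall x, t k x @[k --> \oo] --> f_ n.+1 x - f_ n x}.
  have [t [st tf]] : strongly_measurable mu (-1 *: f_ n + f_ n.+1).
    exact: strongly_measurableZD.
  exists t; split=> //; apply: filterS tf => x.
  by rewrite !fctE scaleN1r addrC.
pose trunc n (y : E) := if nrm y <= 2 * C * 2^-1 ^+ n then y else 0.
pose S k := s0 k + \sum_(n <- iota 0 k) (trunc n \o t n k).
have truncle n y : nrm (trunc n y) <= 2 * C * 2^-1 ^+ n.
  rewrite /trunc; case: ifP => // _; rewrite nrm0 !mulr_ge0 ?geometric_ratio_ge0//.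
  exact: ltW.
exists S; split=> [k|].
  rewrite /S -[s0 k]scale1r; apply: simple_functionZD => //.
  by apply: simple_function_sum => n; apply: simple_function_comp; case: (tP n) => + _; exact.
have tf : {ae mu, forall x, forall n, t n k x @[k --> \oo] --> f_ n.+1 x - f_ n x}.
  by apply: ae_foralln => n; case: (tP n).
apply: filterS (filterI (filterI df ff) (filterI s0f tf)).
move=> x [[dfx ffx] [s0x tx]].
(* The limit has norm at most half the cutoff, so the truncation is eventually inactive and does not
   change the limit. *)
have truncx n : trunc n (t n k x) @[k --> \oo] --> f_ n.+1 x - f_ n x.
  apply: cvg_trans (tx n); apply: near_eq_cvg.
  have p0 : 0 < C * 2^-1 ^+ n by rewrite mulr_gt0// exprn_gt0// invr_gt0.
  have /cvg_nrmP /(_ _ p0) := tx n; apply: filterS => k tk.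
  rewrite /trunc ifT//; rewrite nrm_distC in tk.
  by have := nrm_le_add_dist (t n k x) (f_ n.+1 x - f_ n x); have := dfx n; lra.
have partial m :
    s0 k x + \sum_(n <- iota 0 m) trunc n (t n k x) @[k --> \oo] --> f_ m x.
  elim: m => [|m IH].
    by under eq_fun do rewrite /= big_nil addr0.
  under eq_fun do rewrite -addn1 iotaD add0n big_cat big_seq1/= addrA.
  by rewrite -[f_ m.+1 x](subrK (f_ m x)) [_ - _ + _]addrC; exact: cvgD.
apply/cvg_nrmP => e e0; have e2 : 0 < e / 2 by rewrite divr_gt0.
(* The constant 6 is 2 + 4: [2 * C] for the distance from [f_ m] to [f], and [4 * C] for the
   truncated terms from [m] on, whose bounds start from [2 * C]. The other [e / 2] pays for the
   first [m] terms. *)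
have [m _ /(_ m (leqnn m)) me] := geometric_small (6 * C) e2.
move/cvg_nrmP: (partial m) => /(_ _ e2) Pm; near=> k.
have mk : (m <= k)%N by near: k; exact: nbhs_infty_ge.
have kP : nrm (f_ m x - (s0 k x + \sum_(n <- iota 0 m) trunc n (t n k x))) < e / 2.
  by near: k.
pose u j := \sum_(n <- iota 0 j) trunc n (t n k x).
have ustep j : nrm (u j.+1 - u j) <= 2 * C * 2^-1 ^+ j.
  by rewrite /u -addn1 iotaD add0n big_cat big_seq1/= addrAC subrr add0r truncle.
have := geometric_tail ustep mk.
have := @geometric_ratio_ge0 R k; set q := 2^-1 ^+ k => q0.
have Cq : 0 <= C * q by rewrite mulr_ge0// ltW.
have -> : S k x = s0 k x + u k by rewrite /S !fctE fct_sumE.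
have := nrm_dist_triangle (f_ m x) (f x) (s0 k x + u k).
have := nrm_dist_triangle (s0 k x + u m) (f_ m x) (s0 k x + u k).
rewrite (_ : s0 k x + u m - (s0 k x + u k) = u m - u k); last first.
  by rewrite opprD addrACA subrr add0r.
rewrite [nrm (u m - u k)]nrm_distC.
have := ffx m; rewrite nrm_distC; move: kP; rewrite -/(u m).
lra.
Unshelve. all: by end_near. Qed.

Lemma Linf_le (u : Linf mu E) (K : R) : 0 <= K ->
  nrm u <= K <-> {ae mu, forall x, nrm (u x) <= K}.
Proof.
move=> K0; rewrite nrm_Linf; split; last exact: ess_norm_le.
move=> uK; apply: filterS (ess_norm_ub (Linf_fun_bounded (Linf_repr u))) => x /le_trans.
exact.
Qed.

Lemma Linf_complete : geometrically_complete E -> geometrically_complete (Linf mu E).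
Proof.
move=> Ec; refine (fun (u : nat -> Linf mu E) (C : R) uC => _).
have C0 : 0 <= C.
  by have := uC 0; rewrite expr0 mulr1; apply: le_trans (nrm_ge0 _).
have Cn0 n : 0 <= C * 2^-1 ^+ n by rewrite mulr_ge0// geometric_ratio_ge0.
have uB n : {ae mu, forall x, (u n.+1 - u n : Linf mu E) x = u n.+1 x - u n x}.
  rewrite -scaleN1r; apply: filterS2 (Linf_reprD (u n.+1) (-1 *: u n)) (Linf_reprZ (-1) (u n)).
  by move=> x -> ->; rewrite scaleN1r.
have du : {ae mu, forall x, forall n, nrm (u n.+1 x - u n x) <= C * 2^-1 ^+ n}.
  apply: ae_foralln => n; move: (uC n) => /(Linf_le _ (Cn0 n)).
  by apply: filterS2 (uB n) => x ->.
(* The implication makes the choice possible at every point; on the null set where the increments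
   misbehave any value will do. *)
have /choice[f fP] x : exists l, (forall n, nrm (u n.+1 x - u n x) <= C * 2^-1 ^+ n) ->
    forall n, nrm (u n x - l) <= 2 * C * 2^-1 ^+ n.
  have [ux|nux] := pselect (forall n, nrm (u n.+1 x - u n x) <= C * 2^-1 ^+ n).
    by have [l lP] := Ec _ _ ux; exists l.
  by exists 0.
have fu : {ae mu, forall x, forall n, nrm (u n x - f x) <= 2 * C * 2^-1 ^+ n}.
  exact: filterS du.
have fL : f \in Linf_function mu E.
  (* The measurability lemma asks for a positive constant, while [C] may be zero. *)
  have leC n : C * 2^-1 ^+ n <= (C + 1) * 2^-1 ^+ n.
    by rewrite ler_wpM2r ?geometric_ratio_ge0// lerDl.
  rewrite inE; split.
    apply: (@strongly_measurable_geometric_limit (fun n => u n) f (C + 1)).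
    - by rewrite ltr_wpDl.
    - by move=> n; exact: Linf_fun_measurable.
    - by apply: filterS du => x ux n; exact: le_trans (ux n) (leC n).
    - apply: filterS fu => x ux n; rewrite (le_trans (ux n))// -!mulrA.
      by rewrite ler_wpM2l.
  have [N uN] := Linf_fun_bounded (Linf_repr (u 0)); exists (N + 2 * C).
  apply: filterS2 uN fu => x uN /(_ 0); rewrite expr0 mulr1 nrm_distC => fux.
  by rewrite (le_trans (nrm_le_add_dist _ (u 0 x)))// lerD.
exists (Linf_class (LinfFun fL)) => n.
apply/Linf_le; first by rewrite -mulrA mulr_ge0.
have lB : {ae mu, forall x, (u n - Linf_class (LinfFun fL) : Linf mu E) x = u n x - f x}.
  rewrite -scaleN1r.
  apply: filterS3 (Linf_reprD (u n) (-1 *: Linf_class (LinfFun fL)))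
    (Linf_reprZ (-1) (Linf_class (LinfFun fL))) (Linf_reprK (LinfFun fL)) => x.
  by move=> -> -> ->; rewrite scaleN1r.
by apply: filterS2 lB fu => x ->.
Qed.

End Linf_completeness.

(** * Extension of contractive linear relations by continuity *)

Section graph_closure.
Context {R : realType} {V W : normedModType R[i]}.
Variable P : V -> W -> Prop.

(** A relation is used because different families may give the same operator: that the
    correspondence of finite sums is single-valued follows from contractivity. Closing the graph in
    both variables extends it at the same time. *)
Definition graph_closure (b : V) (c : W) := forall e : R, 0 < e ->
  exists b' c', [/\ P b' c', nrm (b - b') < e & nrm (c - c') < e].

Lemma sub_graph_closure b c : P b c -> graph_closure b c.
Proof. by move=> bc e e0; exists b, c; rewrite !subrr !nrm0. Qed.

Hypothesis P_linear : forall (l : R[i]) b c b' c',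
  P b c -> P b' c' -> P (l *: b + b') (l *: c + c').

Lemma graph_closure_linear (l : R[i]) b c b' c' :
  graph_closure b c -> graph_closure b' c' ->
  graph_closure (l *: b + b') (l *: c + c').
Proof.
move=> bc bc' e e0; pose k := nrm (l : R[i]^o) + 1.
have k0 : 0 < k by rewrite ltr_wpDl ?nrm_ge0.
have e2 : 0 < e / 2 by rewrite divr_gt0.
have ek : 0 < e / 2 / k by rewrite divr_gt0.
have [b1 [c1 [P1 bb1 cc1]]] := bc _ ek; have [b2 [c2 [P2 bb2 cc2]]] := bc' _ e2.
have small (U : normedModType R[i]) (x y x' y' : U) : nrm (x - x') < e / 2 / k ->
    nrm (y - y') < e / 2 -> nrm (l *: x + y - (l *: x' + y')) < e.
  move=> xx' yy'; rewrite opprD addrACA -scalerBr (le_lt_trans (nrmD _ _))//.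
  rewrite (splitr e) ler_ltD// nrmZ; apply: le_trans (_ : k * nrm (x - x') <= _).
    by rewrite ler_wpM2r ?nrm_ge0// lerDl.
  by rewrite mulrC -ler_pdivlMr// ltW.
by exists (l *: b1 + b2), (l *: c1 + c2); split; [exact: P_linear|exact: small|exact: small].
Qed.

Hypothesis P_contraction : forall b c, P b c -> nrm c <= nrm b.

Lemma graph_closure_contraction b c : graph_closure b c -> nrm c <= nrm b.
Proof.
move=> bc; apply/ler_addgt0Pr => e e0; have e2 : 0 < e / 2 by rewrite divr_gt0.
have [b1 [c1 [/P_contraction P1 bb1 cc1]]] := bc _ e2.
have := nrm_le_add_dist c c1; have := nrm_le_add_dist b1 b.
by rewrite [nrm (b1 - b)]nrm_distC; lra.
Qed.

Lemma graph_closure_dist b c b' c' : graph_closure b c -> graph_closure b' c' ->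
  nrm (c - c') <= nrm (b - b').
Proof.
move=> bc bc'; rewrite addrC -scaleN1r [in leRHS]addrC -[- b']scaleN1r.
exact/graph_closure_contraction/graph_closure_linear.
Qed.

Lemma graph_closure_unique b c c' :
  graph_closure b c -> graph_closure b c' -> c = c'.
Proof.
move=> bc bc'; apply/eqP; rewrite -subr_eq0; apply/eqP/nrm_eq0/le_anti.
by rewrite nrm_ge0 andbT (le_trans (graph_closure_dist bc bc'))// subrr nrm0.
Qed.

Lemma graph_closure_exists b : geometrically_complete W ->
  closure [set b' | exists c', P b' c'] b -> exists c, graph_closure b c.
Proof.
move=> Wc /closure_nrmP bP.
have p0 n : (0 : R) < 2^-1 ^+ n by rewrite exprn_gt0// invr_gt0.
have /choice[bc bcP] n : exists bc : V * W, P bc.1 bc.2 /\ nrm (b - bc.1) < 2^-1 ^+ n.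
  by have [b' [c' Pbc] bb'] := bP _ (p0 n); exists (b', c').
(* Consecutive approximants of [b] are within 2^-(n+1) + 2^-n of each other, which is below
   [2 * 2^-1 ^+ n], and by contractivity so are their partners. *)
have [|c cP] := Wc (fun n => (bc n).2) 2.
  move=> n; have [Pn bn] := bcP n; have [Pn' bn'] := bcP n.+1.
  have := graph_closure_dist (sub_graph_closure Pn') (sub_graph_closure Pn).
  have := nrm_dist_triangle b (bc n.+1).1 (bc n).1; move: bn'.
  by rewrite exprS [nrm (_ - b)]nrm_distC; have := p0 n; lra.
(* The factor [2 * 2] is the rate of [c] for increments of constant 2; it also covers the distance
   from [b] to its approximant. *)
exists c => e e0; have [n _ /(_ n (leqnn n)) ne] := geometric_small (2 * 2) e0.
have [Pn bn] := bcP n; exists (bc n).1, (bc n).2; split=> //.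
  by have := p0 n; lra.
by rewrite nrm_distC (le_lt_trans (cP n)).
Qed.

(** The value 0 off the domain of the closed graph only makes the map total. *)
Definition graph_extension (b : V) : W := xget 0 [set c | graph_closure b c].

Lemma graph_extensionE b c : graph_closure b c -> graph_extension b = c.
Proof.
move=> bc; rewrite /graph_extension; case: xgetP => [c' _ bc'|/(_ c)//].
exact: graph_closure_unique bc' bc.
Qed.

Lemma graph_extensionP b : geometrically_complete W ->
  closure [set b' | exists c', P b' c'] b -> graph_closure b (graph_extension b).
Proof. by move=> Wc /(graph_closure_exists Wc)[c bc]; rewrite (graph_extensionE bc). Qed.

Lemma graph_extension_continuous : geometrically_complete W ->
  {within closure [set b' | exists c', P b' c'], continuous graph_extension}.
Proof.
move=> Wc; apply/subspace_continuousP => b Bb; apply/cvg_nrmP => e e0.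
apply/nbhs_nrmP; exists e => // b' bb' Bb'.
by rewrite (le_lt_trans (graph_closure_dist _ _) bb')//; exact: graph_extensionP.
Qed.

End graph_closure.

Lemma graph_closure_swap (R : realType) (V W : normedModType R[i])
    (P : V -> W -> Prop) b c :
  graph_closure P b c -> graph_closure (fun c' b' => P b' c') c b.
Proof. by move=> bc e /bc[b' [c' [? ? ?]]]; exists c', b'. Qed.

(** * Multiplicative and isometric relations between operators *)

Section graph_of_operators.
Context {R : realType} {Z1 Z2 : normedModType R[i]}.
Variable P : 'L(Z1) -> 'L(Z2) -> Prop.

Lemma bop_comp_nrm (Z : normedModType R[i]) (S T : 'L(Z)) :
  nrm (S ∘ T) <= nrm S * nrm T.
Proof.
apply: bop_nrm_le => [|x]; first by rewrite mulr_ge0 ?nrm_ge0.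
by rewrite (le_trans (bop_le S (T x)))// -mulrA ler_wpM2l ?nrm_ge0 ?bop_le.
Qed.

Lemma bop_compBl (Z : normedModType R[i]) (S S' T : 'L(Z)) :
  (S - S') ∘ T = S ∘ T - S' ∘ T.
Proof. exact/val_inj. Qed.

Lemma bop_compBr (Z : normedModType R[i]) (S T T' : 'L(Z)) :
  S ∘ (T - T') = S ∘ T - S ∘ T'.
Proof. by apply/val_inj/funext => x; exact: (linearB S). Qed.

(** Split the difference as (b - b')c + b'(c - c'); [e <= 1] bounds [nrm b'] by [nrm b + 1], so the
    estimate involves only [b] and [c]. *)
Lemma bop_comp_close (Z : normedModType R[i]) (b c b' c' : 'L(Z)) (e : R) :
  e <= 1 -> nrm (b - b') < e -> nrm (c - c') < e ->
  nrm (b ∘ c - b' ∘ c') <= e * (nrm c + nrm b + 1).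
Proof.
move=> e1 bb' cc'.
have := nrm_dist_triangle (b' ∘ c) (b ∘ c) (b' ∘ c').
rewrite -bop_compBl -bop_compBr.
have := bop_comp_nrm (b - b') c; have := bop_comp_nrm b' (c - c').
have : nrm (b - b') * nrm c <= e * nrm c by rewrite ler_wpM2r ?nrm_ge0// ltW.
have b'le : nrm b' <= nrm b + 1.
  have := nrm_le_add_dist b' b; rewrite nrm_distC => /le_trans; apply.
  by rewrite lerD2l (le_trans (ltW bb')).
have : nrm b' * nrm (c - c') <= (nrm b + 1) * e.
  by rewrite ler_pM ?nrm_ge0// ltW.
lra.
Qed.

Hypothesis P_mul : forall b c b' c', P b c -> P b' c' -> P (b ∘ b') (c ∘ c').

Lemma graph_closure_mul b c b' c' : graph_closure P b c -> graph_closure P b' c' ->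
  graph_closure P (b ∘ b') (c ∘ c').
Proof.
(* [k] strictly exceeds the factor of [bop_comp_close] on both sides of the relation, so one
   tolerance [d] serves for both products. *)
move=> bc bc' e e0; pose k := nrm b + nrm b' + nrm c + nrm c' + 2.
have [[[b0 b'0] c0] c'0] := (nrm_ge0 b, nrm_ge0 b', nrm_ge0 c, nrm_ge0 c').
have k0 : 0 < k by rewrite /k; lra.
pose d := Num.min 1 (e / k).
have d0 : 0 < d by rewrite lt_min ltr01 divr_gt0.
have d1 : d <= 1 by rewrite ge_min lexx.
have dk : d * k <= e by rewrite -ler_pdivlMr// ge_min lexx orbT.
have [b1 [c1 [P1 bb1 cc1]]] := bc _ d0; have [b2 [c2 [P2 bb2 cc2]]] := bc' _ d0.
exists (b1 ∘ b2), (c1 ∘ c2); split; first exact: P_mul.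
  rewrite (le_lt_trans (bop_comp_close d1 bb1 bb2))// (lt_le_trans _ dk)//.
  by rewrite ltr_pM2l// /k; lra.
rewrite (le_lt_trans (bop_comp_close d1 cc1 cc2))// (lt_le_trans _ dk)//.
by rewrite ltr_pM2l// /k; lra.
Qed.

Hypothesis P_linear : forall (l : R[i]) b c b' c',
  P b c -> P b' c' -> P (l *: b + b') (l *: c + c').
Hypothesis P_isometry : forall b c, P b c -> nrm c = nrm b.

Lemma graph_closure_isometry b c : graph_closure P b c -> nrm c = nrm b.
Proof.
move=> bc; apply/le_anti/andP; split.
  by apply: (graph_closure_contraction (P := P)) => // b' c' /P_isometry ->.
apply: (graph_closure_contraction (P := fun c' b' => P b' c')).
  by move=> b' c' /P_isometry ->.
exact: graph_closure_swap.
Qed.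

(** An isometric relation is contractive in both directions. Uniqueness and existence for the
    swapped relation give injectivity and surjectivity of the extension. *)
Lemma isometric_isomorphism_closure :
  geometrically_complete Z1 -> geometrically_complete Z2 ->
  isometric_isomorphism (closure [set b | exists c, P b c])
    (closure [set c | exists b, P b c]) (graph_extension P) /\
  forall b c, P b c -> graph_extension P b = c.
Proof.
move=> Z1c Z2c.
have P_le b c : P b c -> nrm c <= nrm b by move=> /P_isometry ->.
have P_ge c b : P b c -> nrm b <= nrm c by move=> /P_isometry ->.
have extE := graph_extensionE P_linear P_le.
have extP b := @graph_extensionP _ _ _ P P_linear P_le b (bop_complete Z2c).
split; last by move=> b c bc; apply: extE; exact: sub_graph_closure.
have Psym (l : R[i]) c b c' b' : P b c -> P b' c' -> P (l *: b + b') (l *: c + c').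
  by move=> Pbc; exact: P_linear.
split; first split.
- move=> b /extP bc; apply/closure_nrmP => e /bc[b' [c' [Pbc bb' cc']]].
  by exists c' => //; exists b'.
- move=> b b' /set_mem /extP bc /set_mem /extP; rewrite -[in X in X -> _]/(graph_extension P b).
  move=> bc' bb'; rewrite bb' in bc.
  apply: (@graph_closure_unique _ _ _ (fun c b => P b c) Psym P_ge
    (graph_extension P b')); exact: graph_closure_swap.
- move=> c Bc; have [b cb] := @graph_closure_exists _ _ _ (fun c b => P b c)
    Psym P_ge c (bop_complete Z1c) Bc.
  have bc : graph_closure P b c by exact: graph_closure_swap cb.
  exists b; last exact: extE.
  by apply/closure_nrmP => e /bc[b' [c' [Pbc bb' cc']]]; exists b' => //; exists c'.
- by move=> b /extP bc; rewrite !nrmE (graph_closure_isometry bc).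
- move=> l b c /extP bP /extP cP; apply: extE; exact: graph_closure_linear.
- move=> b c /extP bP /extP cP; apply: extE; exact: graph_closure_mul.
Qed.

End graph_of_operators.

(** * Covariant representations *)

Section finite_sums.
Context {R : realType} {G : groupType} {A : lmodType R[i]}.

Lemma bop_sumE (V W : normedModType R[i]) (I : Type) (s : seq I) (S : I -> bop V W) x :
  (\sum_(i <- s) S i) x = \sum_(i <- s) S i x.
Proof. exact: (big_morph (fun S : bop V W => S x)). Qed.

(** A finite sum sees [a] only on [F]. Cutting it off there makes its value at [g] the true
    coefficient and allows [F] to be enlarged. *)
Definition extend0 (F : {fset G}) (a : G -> A) (g : G) : A :=
  if g \in F then a g else 0.

(** This is what is needed to add two sums over different index sets, by passing to their union.
    Besides finite sums of operators, the single coefficient at a fixed [g0] has this form, so the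
    isomorphism and the coefficient maps are extended alike. *)
Record sum_like (V : lmodType R[i]) (Phi : {fset G} -> (G -> A) -> V) : Prop := SumLike {
  sum_like_widen : forall (F K : {fset G}) a, (F `<=` K)%fset -> Phi F a = Phi K (extend0 F a);
  sum_like_linear : forall K l a b, Phi K (fun g => l *: a g + b g) = l *: Phi K a + Phi K b }.

Section graph_of_sums.
Context {V W : lmodType R[i]}.
Variables (Phi : {fset G} -> (G -> A) -> V) (Psi : {fset G} -> (G -> A) -> W).
Hypotheses (Phi_sum : sum_like Phi) (Psi_sum : sum_like Psi).

Definition sum_graph b c := exists F a, b = Phi F a /\ c = Psi F a.

Lemma sum_graph_linear (l : R[i]) b c b' c' :
  sum_graph b c -> sum_graph b' c' -> sum_graph (l *: b + b') (l *: c + c').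
Proof.
move=> [F [a [-> ->]]] [F' [a' [-> ->]]].
exists (F `|` F')%fset, (fun g => l *: extend0 F a g + extend0 F' a' g).
have [FK FK'] := (fsubsetUl F F', fsubsetUr F F').
by rewrite !(sum_like_linear Phi_sum) !(sum_like_linear Psi_sum)
  -!(sum_like_widen Phi_sum) -?(sum_like_widen Psi_sum).
Qed.

End graph_of_sums.

Lemma coefficient_sum_like (g0 : G) : sum_like (fun F a => extend0 F a g0).
Proof.
split=> [F K a FK|K l a b]; rewrite /extend0.
  by case: (boolP (g0 \in F)) => [/(fsubsetP FK) ->//|_]; case: ifP.
by case: ifP => // _; rewrite scaler0 addr0.
Qed.

Section covariant_representation.
Variables (mulA : A -> A -> A) (oneA : A) (act : G -> A -> A).

(** The product, unit and action on [A] are plain operations shared by all representations; only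
    these identities enter the computations with finite sums. *)
Record covariant (Z : normedModType R[i]) (M : A -> 'L(Z)) (T : G -> 'L(Z)) : Prop :=
  Covariant {
    covariant_linear : forall (l : R[i]) a b, M (l *: a + b) = l *: M a + M b;
    covariantM : forall a b, M (mulA a b) = M a ∘ M b;
    covariant1 : forall z, M oneA z = z;
    covariantT1 : forall z, T 1%g z = z;
    covariantTM : forall g h, T (g * h)%g = T g ∘ T h;
    covariant_act : forall g a, T g ∘ M a = M (act g a) ∘ T g }.

Section one_representation.
Context {Z : normedModType R[i]} {M : A -> 'L(Z)} {T : G -> 'L(Z)}.
Hypothesis MT : covariant M T.

Lemma covariant0 : M 0 = 0.
Proof.
have := covariant_linear MT 1 0 0; rewrite !scale1r addr0 => /esym/eqP.
by rewrite -subr_eq0 addrK => /eqP.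
Qed.

Lemma finite_sum_sum_like : sum_like (finite_sum M T).
Proof.
split=> [F K a FK|K l a b]; rewrite /finite_sum.
  rewrite -(big_fset_incl _ FK) => [|g gK gF].
    by apply: eq_big_seq => g gF; rewrite /extend0 gF.
  by rewrite /extend0 (negbTE gF) covariant0; apply/val_inj.
rewrite scaler_sumr -big_split; apply: eq_bigr => g _ /=.
by rewrite (covariant_linear MT); apply/val_inj.
Qed.

Lemma finite_sum1 g a : finite_sum M T [fset g]%fset (fun=> a) = M a ∘ T g.
Proof. by rewrite /finite_sum big_seq_fset1. Qed.

Lemma finite_sumE F a z : finite_sum M T F a z = \sum_(g <- F) M (a g) (T g z).
Proof. exact: bop_sumE. Qed.

Lemma finite_sum_oneA g : finite_sum M T [fset g]%fset (fun=> oneA) = T g.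
Proof. by rewrite finite_sum1; apply/val_inj/funext => z; exact: (covariant1 MT). Qed.

Lemma finite_sum_oneG a : finite_sum M T [fset 1%g]%fset (fun=> a) = M a.
Proof.
by rewrite finite_sum1; apply/val_inj/funext => z /=; rewrite (covariantT1 MT).
Qed.

(** Moving [T g] past [M b] gives the same twisted product in every covariant representation, which
    is why the correspondence of finite sums is multiplicative. *)
Lemma covariant_monomialM a g b h :
  (M a ∘ T g) ∘ (M b ∘ T h) = M (mulA a (act g b)) ∘ T (g * h)%g.
Proof.
rewrite (covariantM MT) (covariantTM MT); apply/val_inj/funext => z /=.
by congr (M a _); have := congr1 (fun S : 'L(Z) => S (T h z)) (covariant_act MT g b).
Qed.

End one_representation.

Section two_representations.
Context {Z1 Z2 : normedModType R[i]}.
Variables (M1 : A -> 'L(Z1)) (T1 : G -> 'L(Z1)) (M2 : A -> 'L(Z2)) (T2 : G -> 'L(Z2)).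
Hypotheses (MT1 : covariant M1 T1) (MT2 : covariant M2 T2).

Local Notation graph := (sum_graph (finite_sum M1 T1) (finite_sum M2 T2)).

Let graph_linear (l : R[i]) b c b' c' : graph b c -> graph b' c' ->
  graph (l *: b + b') (l *: c + c').
Proof. by apply: sum_graph_linear; exact: finite_sum_sum_like. Qed.

Lemma finite_sum_graph_sum (I : Type) (s : seq I) (b : I -> 'L(Z1)) (c : I -> 'L(Z2)) :
  (forall i, graph (b i) (c i)) -> graph (\sum_(i <- s) b i) (\sum_(i <- s) c i).
Proof.
move=> bc; elim: s => [|i s IH].
  by rewrite !big_nil; exists fset0, (fun=> 0); rewrite /finite_sum !big_seq_fset0.
by rewrite !big_cons -[b i]scale1r -[c i]scale1r; exact: graph_linear.
Qed.

Lemma finite_sum_graph_mul b c b' c' : graph b c -> graph b' c' ->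
  graph (b ∘ b') (c ∘ c').
Proof.
have comp_sum (Z : normedModType R[i]) (M : A -> 'L(Z)) (T : G -> 'L(Z)) F a F' a' :
    finite_sum M T F a ∘ finite_sum M T F' a' =
    \sum_(g <- F) \sum_(h <- F') ((M (a g) ∘ T g) ∘ (M (a' h) ∘ T h)).
  apply/val_inj/funext => z /=; rewrite !bop_sumE; apply: eq_bigr => g _.
  by rewrite !bop_sumE !linear_sum.
move=> [F [a [-> ->]]] [F' [a' [-> ->]]]; rewrite !comp_sum.
apply: finite_sum_graph_sum => g; apply: finite_sum_graph_sum => h.
rewrite (covariant_monomialM MT1) (covariant_monomialM MT2).
exists [fset (g * h)%g]%fset, (fun=> mulA (a g) (act g (a' h))).
by rewrite !finite_sum1.
Qed.

Lemma canonically_isomorphic_nrm :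
  geometrically_complete Z1 -> geometrically_complete Z2 ->
  (forall F a, nrm (finite_sum M2 T2 F a) = nrm (finite_sum M1 T1 F a)) ->
  canonically_isomorphic M1 T1 M2 T2.
Proof.
move=> Z1c Z2c nrmE.
have [|isoP extE] := isometric_isomorphism_closure finite_sum_graph_mul graph_linear _ Z1c Z2c.
  by move=> _ _ [F [a [-> ->]]].
exists (graph_extension graph); split.
- move: isoP; rewrite /crossed_algebra.
  rewrite (_ : [set b | exists c, graph b c] = [set b | exists F a, b = finite_sum M1 T1 F a]); last first.
    by apply/seteqP; split=> b /=; [move=> [c [F [a [-> _]]]]; exists F, a|
      move=> [F [a ->]]; exists (finite_sum M2 T2 F a), F, a].
  rewrite (_ : [set c | exists b, graph b c] = [set c | exists F a, c = finite_sum M2 T2 F a])//.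
  by apply/seteqP; split=> b /=; [move=> [c [F [a [_ ->]]]]; exists F, a|
    move=> [F [a ->]]; exists (finite_sum M1 T1 F a), F, a].
- move=> a; apply: extE; exists [fset 1%g]%fset, (fun=> a).
  by rewrite !finite_sum_oneG.
- move=> g; apply: extE; exists [fset g]%fset, (fun=> oneA).
  by rewrite !finite_sum_oneA.
Qed.

End two_representations.
End covariant_representation.
End finite_sums.

(** * Regular representations *)

Section regular_representation.
Context {R : realType} {G : groupType} {A : lmodType R[i]} {Z H : normedModType R[i]}.
Variables (mulA : A -> A -> A) (oneA : A) (act : G -> A -> A).
Context {M : A -> 'L(Z)} {T : G -> 'L(Z)}.
Hypothesis MT : covariant mulA oneA act M T.
Context {ev : H -> G -> Z}.
Hypothesis evP : sup_normed ev.
Context {D : A -> 'L(H)} {V : G -> 'L(H)}.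
Hypothesis DE : forall a xi k, ev (D a xi) k = conj_op M T k a (ev xi k).
Hypothesis VE : forall g xi k, ev (V g xi) k = ev xi (k * g)%g.

Lemma covariantTK g z : T g^-1%g (T g z) = z.
Proof.
have /= <- := congr1 (fun S : 'L(Z) => S z) (covariantTM MT g^-1%g g).
by rewrite mulVg (covariantT1 MT).
Qed.

Lemma covariantTVK g z : T g (T g^-1%g z) = z.
Proof. by rewrite -{1}[g]invgK covariantTK. Qed.

Lemma regular_covariant : covariant mulA oneA act D V.
Proof.
have ext (S S' : 'L(H)) : (forall xi k, ev (S xi) k = ev (S' xi) k) -> S = S'.
  by move=> SS'; apply/val_inj/funext => xi; apply: (ev_inj evP) => k; exact: SS'.
split=> [l a b|a b|xi|xi|g h|g a].
- apply: ext => xi k; rewrite (ev_linear evP) !DE /conj_op /=.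
  by rewrite (covariant_linear MT); exact: (linearP (T k)).
- apply: ext => xi k; rewrite /= !DE /conj_op /= (covariantM MT) /=.
  by rewrite covariantTK.
- apply: (ev_inj evP) => k; rewrite DE /conj_op /= (covariant1 MT).
  exact: covariantTVK.
- by apply: (ev_inj evP) => k; rewrite VE mulg1.
- by apply: ext => xi k; rewrite /= !VE mulgA.
(* At the coordinate [k] both sides are applied to the coordinate [k * g] of [xi]; inside the
   conjugation by [T k], conjugating [M a] by [T g] gives [M (act g a)]. *)
- apply: ext => xi k; rewrite /= VE !DE VE /conj_op /= (covariantTM MT) invgM.
  rewrite (covariantTM MT) /=; congr (T k _).
  have := congr1 (fun S : 'L(Z) => S (T g^-1%g (T k^-1%g (ev xi (k * g)%g))))
    (covariant_act MT g a).
  by move=> /= ->; rewrite covariantTVK.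
Qed.

Lemma regular_finite_sumE F a xi k :
  ev (finite_sum D V F a xi) k = \sum_(h <- F) conj_op M T k (a h) (ev xi (k * h)%g).
Proof.
rewrite finite_sumE (ev_sum evP); apply: eq_bigr => h _.
by rewrite DE VE.
Qed.

End regular_representation.

(** * Finitely supported families and matrix entries *)

Section finitely_supported.
Context {R : realType} {G : choiceType} {Z : normedModType R[i]}.

Lemma finitely_supported_vanishing (F : {fset G}) (z : G -> Z) :
  (fun h => if h \in F then z h else 0) \in vanishing_family G Z.
Proof.
rewrite inE => e e0; apply: sub_finite_set (finite_fset F) => h /=.
by case: ifP => // _; rewrite nrm0 leNgt e0.
Qed.

Definition l0_finite F z : l0 G Z := L0 (finitely_supported_vanishing F z).

Lemma finitely_supported_bounded (F : {fset G}) (z : G -> Z) :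
  (fun h => if h \in F then z h else 0) \in bounded_family G Z.
Proof. by rewrite inE; exact: (l0_bounded (l0_finite F z)). Qed.

Definition linf_finite F z : linf G Z := LInf (finitely_supported_bounded F z).

(** Families supported at one point span the finitely supported ones, which are dense in [l0]. The
    cut is made where [xi] has norm at least [e / (nrm S + 1)], the summand 1 keeping the
    denominator positive. *)
Lemma l0_bop_eq0 (W : normedModType R[i]) (S : bop (l0 G Z) W) :
  (forall h z, S (l0_finite [fset h]%fset (fun=> z)) = 0) -> S = 0.
Proof.
move=> S0; apply/val_inj/funext => xi /=; apply: nrm_sub_le_small => e e0.
rewrite subr0; have d0 : 0 < e / (nrm S + 1) by rewrite divr_gt0// ltr_wpDl// nrm_ge0.
have := l0P xi; rewrite inE => /(_ _ d0)/finite_fsetP[F xiF].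
have SF : S (l0_finite F xi) = 0.
  rewrite (_ : l0_finite F xi = \sum_(h <- F) l0_finite [fset h]%fset (fun=> xi h)).
    by rewrite linear_sum big1 => [|h _]; [|exact: S0].
  apply: (ev_inj (@l0_sup_normed R G Z)) => g; rewrite (ev_sum (@l0_sup_normed R G Z)) /=.
  case: ifPn => gF.
    rewrite (big_fsetD1 g)//= inE eqxx big_seq big1 ?addr0// => h.
    by rewrite !inE eq_sym => /andP[/negbTE->].
  rewrite big_seq big1// => h hF; rewrite inE; case: eqP => // gh.
  by rewrite gh hF in gF.
rewrite -[S xi]subr0 -SF -linearB (le_trans (bop_le _ _))//.
have : nrm (xi - l0_finite F xi) <= e / (nrm S + 1).
  apply: (nrm_le_ev (@l0_sup_normed R G Z)) => [|g]; first exact: ltW.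
  rewrite (evB (@l0_sup_normed R G Z)) /=; case: ifPn => gF.
    by rewrite subrr nrm0 ltW.
  rewrite subr0 leNgt; apply/negP => /ltW xig; move/negP: gF; apply.
  by have : [set` F] g by rewrite -xiF.
move=> /(ler_wpM2l (nrm_ge0 S)) /le_trans; apply.
by rewrite mulrCA ler_piMr ?(ltW e0)// ler_pdivrMr ?mul1r ?lerDl// ltr_wpDl// nrm_ge0.
Qed.

End finitely_supported.

Lemma bop0 (R : realType) (V W : normedModType R[i]) (S : bop V W) : S 0 = 0.
Proof. exact: linear0. Qed.

Lemma bopZ (R : realType) (V W : normedModType R[i]) (S : bop V W) l x :
  S (l *: x) = l *: S x.
Proof. exact: linearZ. Qed.

(** This computes the matrix entry at row [g] and column [h]: only the term [k] with g k = h meets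
    the support of [xi]. *)
Lemma regular_finite_sum_delta {R : realType} {G : groupType} {A : lmodType R[i]}
    {Z H : normedModType R[i]} (mulA : A -> A -> A) (oneA : A) (act : G -> A -> A)
    (M : A -> 'L(Z)) (T : G -> 'L(Z)) (ev : H -> G -> Z) (D : A -> 'L(H)) (V : G -> 'L(H)) :
  covariant mulA oneA act M T -> sup_normed ev ->
  (forall a xi k, ev (D a xi) k = conj_op M T k a (ev xi k)) ->
  (forall g xi k, ev (V g xi) k = ev xi (k * g)%g) ->
  forall F a xi h z, (forall k, ev xi k = if k == h then z else 0) ->
  forall g, ev (finite_sum D V F a xi) g = conj_op M T g (extend0 F a (g^-1 * h)%g) z.
Proof.
move=> MT evP DE VE F a xi h z xiE g; rewrite (regular_finite_sumE evP DE VE).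
have off k : k != (g^-1 * h)%g -> conj_op M T g (a k) (ev xi (g * k)%g) = 0.
  move=> kE; rewrite xiE ifN ?bop0//.
  by apply: contraNneq kE => <-; rewrite mulKg.
rewrite /extend0; case: ifPn => kF.
  rewrite (big_fsetD1 _ kF)/= xiE mulVKg eqxx big_seq big1 ?addr0// => k.
  by rewrite !inE => /andP[/off].
rewrite [RHS](_ : _ = 0); last by rewrite /conj_op (covariant0 MT); exact: (bop0 (T g)).
rewrite big_seq big1// => k kin; apply: off.
by apply: contraNneq kF => <-.
Qed.

Lemma bop_scaleE (R : realType) (V W : normedModType R[i]) (S : bop V W) l x :
  (l *: S) x = l *: S x.
Proof. by []. Qed.

Lemma bcont_scaleE (R : realType) (X : topologicalType) (B : normedModType R[i])
  (a : bcont X B) l x : (l *: a) x = l *: a x.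
Proof. by []. Qed.

Section concrete_regular_representations.
Context {R : realType} {G : groupType} {A : lmodType R[i]} {Z : normedModType R[i]}.
Variables (mulA : A -> A -> A) (oneA : A) (act : G -> A -> A).
Context {M : A -> 'L(Z)} {T : G -> 'L(Z)}.
Hypothesis MT : covariant mulA oneA act M T.
Hypothesis T_contr : forall g, nrm (T g) <= 1.

Lemma diag_l0E a (xi : l0 G Z) k : diag_l0 M T_contr a xi k = conj_op M T k a (xi k).
Proof. by []. Qed.

Lemma shift_l0E g (xi : l0 G Z) k : shift_l0 g xi k = xi (k * g)%g.
Proof. by []. Qed.

Lemma diag_linfE a (xi : linf G Z) k :
  diag_linf M T_contr a xi k = conj_op M T k a (xi k).
Proof. by []. Qed.

Lemma shift_linfE g (xi : linf G Z) k : shift_linf g xi k = xi (k * g)%g.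
Proof. by []. Qed.

Lemma l0_covariant : covariant mulA oneA act (diag_l0 M T_contr) (@shift_l0 R G Z).
Proof. exact: (regular_covariant MT (@l0_sup_normed R G Z) diag_l0E shift_l0E). Qed.

Lemma linf_covariant : covariant mulA oneA act (diag_linf M T_contr) (@shift_linf R G Z).
Proof. exact: (regular_covariant MT (@linf_sup_normed R G Z) diag_linfE shift_linfE). Qed.

Lemma l0_finiteP (F : {fset G}) (z : G -> Z) :
  exists xi : l0 G Z, forall h, xi h = if h \in F then z h else 0.
Proof. by exists (l0_finite F z). Qed.

Lemma linf_finiteP (F : {fset G}) (z : G -> Z) :
  exists xi : linf G Z, forall h, xi h = if h \in F then z h else 0.
Proof. by exists (linf_finite F z). Qed.

End concrete_regular_representations.

(** * Multiplications and translations on L^oo *)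

Section Linf_facts.
Context {R : realType} {d : measure_display} {T : measurableType d}.
Context {mu : {measure set T -> \bar R}} {E : normedModType R[i]}.

Lemma Linf_ext (u v : Linf mu E) : {ae mu, forall x, u x = v x} -> u = v.
Proof. by move=> uv; rewrite -[u]Linf_classK -[v]Linf_classK; exact/Linf_classP. Qed.

Lemma Linf_repr_linear l (u v : Linf mu E) :
  {ae mu, forall x, (l *: u + v : Linf mu E) x = l *: u x + v x}.
Proof. by apply: filterS2 (Linf_reprD (l *: u) v) (Linf_reprZ l u) => x -> ->. Qed.

Lemma Linf_repr_sum (I : Type) (s : seq I) (u : I -> Linf mu E) :
  {ae mu, forall x, (\sum_(i <- s) u i : Linf mu E) x = \sum_(i <- s) u i x}.
Proof.
elim: s => [|i s IH].
  have := Linf_reprZ 0 (0 : Linf mu E); rewrite scale0r; apply: filterS => x.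
  by rewrite !big_nil => ->; rewrite scale0r.
rewrite big_cons; apply: filterS2 (Linf_reprD (u i) (\sum_(j <- s) u j)) IH => x -> ->.
by rewrite big_cons.
Qed.

Lemma ae_eq_sum (I : Type) (s : seq I) (f g : I -> T -> E) :
  (forall i, {ae mu, forall x, f i x = g i x}) ->
  {ae mu, forall x, \sum_(i <- s) f i x = \sum_(i <- s) g i x}.
Proof.
move=> fg; elim: s => [|i s IH]; first by apply: aeW => x; rewrite !big_nil.
by apply: filterS2 (fg i) IH => x fgi IHx; rewrite !big_cons fgi IHx.
Qed.

End Linf_facts.

(** * Product, unit and composition for operator-valued continuous functions *)

Section operator_valued_functions.
Context {R : realType} {X : topologicalType} {E : normedModType R[i]}.

Lemma bcont_mul_subproof (a b : bcont X 'L(E)) :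
  (fun x => a x ∘ b x) \in bounded_continuous X 'L(E).
Proof.
have bsup := @bcont_sup_normed R X 'L(E).
rewrite inE; split; last first.
  exists (nrm a * nrm b) => x _; rewrite (le_trans (bop_comp_nrm _ _))//.
  by rewrite ler_pM ?nrm_ge0// (nrm_ev_le bsup).
apply/continuous_nrmP => x e e0; pose k := nrm (a x) + nrm (b x) + 2.
have [a0 b0] := (nrm_ge0 (a x), nrm_ge0 (b x)).
have k0 : 0 < k by rewrite /k; lra.
pose r := Num.min 1 (e / k).
have r0 : 0 < r by rewrite lt_min ltr01 divr_gt0.
have r1 : r <= 1 by rewrite ge_min lexx.
have rk : r * k <= e by rewrite -ler_pdivlMr// ge_min lexx orbT.
apply: filterS2 (bcont_nrmP a x r0) (bcont_nrmP b x r0) => y ay yb.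
rewrite (le_lt_trans (bop_comp_close r1 ay yb))// (lt_le_trans _ rk)//.
by rewrite ltr_pM2l// /k; lra.
Qed.

Definition bcont_mul (a b : bcont X 'L(E)) := BCont (bcont_mul_subproof a b).

Lemma id_bop_subproof : (id : E -> E) \in bounded_operator E E.
Proof. by apply: mk_bop_subproof => //; exists 1 => x; rewrite mul1r. Qed.

Definition id_bop : 'L(E) := Bop id_bop_subproof.

Lemma bcont_cst_subproof (B : normedModType R[i]) (y : B) :
  (fun=> y) \in bounded_continuous X B.
Proof.
rewrite inE; split; first by move=> x; exact: cvg_cst.
by exists (nrm y).
Qed.

Definition bcont_cst (B : normedModType R[i]) (y : B) := BCont (bcont_cst_subproof y).

Lemma bcont_comp_subproof (B : normedModType R[i]) (a : bcont X B) (h : X -> X) :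
  continuous h -> a \o h \in bounded_continuous X B.
Proof.
move=> hc; have := bcontP a; rewrite !inE => -[ac [N aN]]; split.
  by move=> x; apply: continuous_comp; [exact: hc|exact: ac].
by exists N => x _; exact: aN.
Qed.

Definition bcont_comp (B : normedModType R[i]) (a : bcont X B) (h : X -> X)
  (hc : continuous h) : bcont X B := BCont (bcont_comp_subproof a hc).

End operator_valued_functions.

Section covariance.
Context {R : realType} {X : ptopologicalType} {G : groupType}.
Context {mu : {measure set (borel X) -> \bar R}} {E : normedModType R[i]}.
Context {t : G -> X -> X}.
Variables (acts : acts_by_multiplication mu E).
Variables (t_homeo : homeomorphism_group t) (t_mu : preserves_class mu t).

Local Notation M := (mult_op acts).
Local Notation T := (translation_op t_homeo t_mu).

Definition bcont_act (g : G) (a : bcont X 'L(E)) : bcont X 'L(E) :=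
  bcont_comp a (@homeomorphism_group_continuous _ _ _ t_homeo g^-1%g).

Lemma mult_opE a (u : Linf mu E) : {ae mu, forall x, (M a u : Linf mu E) x = a x (u x)}.
Proof. exact: induced_opE. Qed.

Lemma translation_opE g (u : Linf mu E) :
  {ae mu, forall x, (T g u : Linf mu E) x = u (t g^-1%g x)}.
Proof. exact: induced_opE. Qed.

Lemma homeomorphism_groupKV g x : t g (t g^-1%g x) = x.
Proof. by rewrite -(t_homeo.2) mulgV homeomorphism_group1. Qed.

Lemma mult_translation_covariant :
  covariant bcont_mul (bcont_cst id_bop) bcont_act M T.
Proof.
have ext (S S' : 'L(Linf mu E)) :
    (forall u : Linf mu E, {ae mu, forall x, (S u : Linf mu E) x = (S' u : Linf mu E) x}) -> S = S'.
  by move=> SS'; apply/val_inj/funext => u; apply: Linf_ext; exact: SS'.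
split=> [l a b|a b|u|u|g h|g a].
- apply: ext => u.
  apply: filterS3 (mult_opE (l *: a + b) u) (Linf_repr_linear l (M a u) (M b u))
    (filterI (mult_opE a u) (mult_opE b u)) => x Mab -> [Ma Mb].
  by rewrite Mab Ma Mb.
- apply: ext => u; apply: filterS3 (mult_opE (bcont_mul a b) u)
    (mult_opE a (M b u)) (mult_opE b u) => x -> /= -> ->.
  by [].
- by apply: Linf_ext; apply: filterS (mult_opE (bcont_cst id_bop) u) => x ->.
- apply: Linf_ext; apply: filterS (translation_opE 1%g u) => x ->.
  by rewrite invg1 homeomorphism_group1.
- apply: ext => u; apply: filterS3 (translation_opE (g * h)%g u)
    (translation_opE g (T h u)) (ae_translate t_homeo t_mu g^-1%g (translation_opE h u)).
  by move=> x -> /= -> ->; rewrite invgM t_homeo.2.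
- apply: ext => u; apply: filterS3 (translation_opE g (M a u))
    (mult_opE (bcont_act g a) (T g u))
    (filterI (ae_translate t_homeo t_mu g^-1%g (mult_opE a u)) (translation_opE g u)).
  by move=> x /= -> -> [-> ->].
Qed.

Lemma conj_opE g a (u : Linf mu E) :
  {ae mu, forall x, (conj_op M T g a u : Linf mu E) x = a (t g^-1%g x) (u x)}.
Proof.
apply: filterS3 (translation_opE g (M a (T g^-1%g u)))
  (ae_translate t_homeo t_mu g^-1%g (mult_opE a (T g^-1%g u)))
  (ae_translate t_homeo t_mu g^-1%g (translation_opE g^-1%g u)).
by move=> x /= -> -> ->; rewrite invgK homeomorphism_groupKV.
Qed.

Lemma mult_translation_sumE (F : {fset G}) (a : G -> bcont X 'L(E)) (u : Linf mu E) :
  {ae mu, forall x, (finite_sum M T F a u : Linf mu E) x =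
    \sum_(h <- F) a h x (u (t h^-1%g x))}.
Proof.
rewrite finite_sumE; apply: filterS2 (Linf_repr_sum F (fun h => M (a h) (T h u) : Linf mu E)) _ => [x ->|].
  exact.
by apply: ae_eq_sum => h; apply: filterS2 (mult_opE (a h) (T h u)) (translation_opE h u) => x -> ->.
Qed.

End covariance.

Lemma ae_forall_seq (R : realType) (d : measure_display) (T : measurableType d)
    (mu : {measure set T -> \bar R}) (I : eqType) (s : seq I) (P : I -> T -> Prop) :
  (forall i, {ae mu, forall x, P i x}) ->
  {ae mu, forall x, forall i, i \in s -> P i x}.
Proof.
move=> Pi; elim: s => [|i s IH]; first exact: aeW.
apply: filterS2 (Pi i) IH => x Pix IHx j; rewrite inE => /predU1P[->//|]; exact: IHx.
Qed.

Section step_functions.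
Context {R : realType} {d : measure_display} {T : measurableType d}.
Variables (mu : {measure set T -> \bar R}) (E : normedModType R[i]).

Definition step_function (U : set T) (e : E) (x : T) : E :=
  if x \in U then e else 0.

Lemma step_function_Linf U e : measurable U -> step_function U e \in Linf_function mu E.
Proof.
move=> mU; rewrite inE; split.
  exists (fun=> step_function U e); split; last by apply: aeW => x; exact: cvg_cst.
  move=> _; split.
    apply: sub_finite_set (finite_set2 e 0) => _ [x _ <-].
    by rewrite /step_function; case: ifP => _; [left|right].
  move=> y; rewrite (_ : _ @^-1` _ =
      (if e == y then U else set0) `|` (if 0 == y then ~` U else set0)).
    apply: measurableU; first by case: ifP.
    by case: ifP => // _; exact: measurableC.
  apply/seteqP; rewrite /step_function; split=> x /=.
    case: ifPn => [/set_mem|/negP] Ux <-; rewrite eqxx; [by left|right].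
    by move=> Ux'; apply: Ux; exact/mem_set.
  case=> [|]; case: eqP => [<-|_] // Ux; first by rewrite (mem_set Ux).
  by case: ifPn => // /set_mem.
exists (nrm e); apply: aeW => x; rewrite /step_function; case: ifP => // _.
by rewrite nrm0 nrm_ge0.
Qed.

End step_functions.

(** * Norms of finite sums *)

Section fiberwise_norm.
Context {R : realType} {X : ptopologicalType} {G : groupType}.
Context {mu : {measure set (borel X) -> \bar R}} {E : normedModType R[i]}.
Context {t : G -> X -> X}.
Variables (acts : acts_by_multiplication mu E).
Variables (t_homeo : homeomorphism_group t) (t_mu : preserves_class mu t).

Local Notation M := (mult_op acts).
Local Notation T := (translation_op t_homeo t_mu).
Local Notation MT := (mult_translation_covariant acts t_homeo t_mu).
Local Notation D := (Linf mu E).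

(* The operator [sum_h a_h T_h] acts at the point [x] as the operator
   [(e_h)_h |-> sum_h a_h(x) e_h] from the sup-normed power [E^F] to [E]. *)
Definition fiber_bound (F : {fset G}) (a : G -> bcont X 'L(E)) (K : R) :=
  forall x (e : G -> E), (forall h, nrm (e h) <= 1) ->
  nrm (\sum_(h <- F) a h x (e h)) <= K.

Lemma fiber_boundZ F a K x (v : G -> E) (N : R) :
  fiber_bound F a K -> (forall h, nrm (v h) <= N) ->
  nrm (\sum_(h <- F) a h x (v h)) <= K * N.
Proof.
move=> FK vN; have := le_trans (nrm_ge0 _) (vN 1%g).
(* The general case rescales by the inverse of [N], so [N = 0] is set apart. *)
rewrite le_eqVlt => /predU1P[N0|N0].
  rewrite -N0 mulr0 big1 ?nrm0// => h _.
  have /nrm_eq0 -> : nrm (v h) = 0 by apply/le_anti; rewrite nrm_ge0 andbT N0.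
  exact: linear0.
have nN : nrm (N%:C^-1 : R[i]^o) = N^-1.
  by apply: complexI; rewrite -nrmE normfV fmorphV/= ger0_norm// lecR ltW.
have := FK x (fun h => N%:C^-1 *: v h) _; under eq_bigr do rewrite linearZ/=.
rewrite -scaler_sumr nrmZ nN mulrC ler_pdivrMr//; apply=> h.
by rewrite nrmZ nN mulrC ler_pdivrMr// mul1r.
Qed.

(** At almost every [x] the sum applies the fibre operator to the values of [u] at the translates of
    [x], and these are bounded by [nrm u] because translations preserve null sets. *)
Lemma fiber_bound_nrm F a K : 0 <= K -> fiber_bound F a K ->
  nrm (finite_sum M T F a) <= K.
Proof.
move=> K0 FK; apply: bop_nrm_le => // u.
apply/(Linf_le _ (mulr_ge0 K0 (nrm_ge0 u))).
have uF : {ae mu, forall x, forall h, h \in (F : seq G) -> nrm ((u : D) (t h^-1%g x)) <= nrm u}.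
  apply: ae_forall_seq => h; have [uu _] := Linf_le u (nrm_ge0 u).
  exact: (ae_translate t_homeo t_mu h^-1%g (uu (lexx _))).
apply: filterS2 (mult_translation_sumE acts t_homeo t_mu F a u) uF => x -> ux.
(* The bound is known for [h] in [F] only, while [fiber_boundZ] wants it for all [h]; zeros are put
   elsewhere. *)
rewrite (_ : \sum_(h <- F) _ =
    \sum_(h <- F) a h x (if h \in F then (u : D) (t h^-1%g x) else 0)).
  apply: fiber_boundZ FK _ => h; case: ifP => [/ux//|_].
  by rewrite nrm0 nrm_ge0.
by apply: eq_big_seq => h ->.
Qed.

Section regular.
Context {H : normedModType R[i]} {ev : H -> G -> D}.
Hypothesis evP : sup_normed ev.
Context {DA : bcont X 'L(E) -> 'L(H)} {V : G -> 'L(H)}.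
Hypothesis DE : forall a xi k, ev (DA a xi) k = conj_op M T k a (ev xi k).
Hypothesis VE : forall g xi k, ev (V g xi) k = ev xi (k * g)%g.

Lemma regular_finite_sum_ae F a xi k : {ae mu, forall x,
  (ev (finite_sum DA V F a xi) k : D) x =
  \sum_(h <- F) a h (t k^-1%g x) ((ev xi (k * h)%g : D) x)}.
Proof.
rewrite (regular_finite_sumE evP DE VE).
apply: filterS2 (Linf_repr_sum F (fun h => conj_op M T k (a h) (ev xi (k * h)%g) : D)) _ => [x ->|].
  exact.
by apply: ae_eq_sum => h; exact: conj_opE.
Qed.

Lemma fiber_bound_regular_nrm F a K : 0 <= K -> fiber_bound F a K ->
  nrm (finite_sum DA V F a) <= K.
Proof.
move=> K0 FK; apply: bop_nrm_le => // xi.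
have KN := mulr_ge0 K0 (nrm_ge0 xi).
apply: (nrm_le_ev evP) => // k; apply/(Linf_le _ KN).
have xiF : {ae mu, forall x, forall h, h \in (F : seq G) ->
    nrm ((ev xi (k * h)%g : D) x) <= nrm xi}.
  apply: ae_forall_seq => h; apply/(Linf_le _ (nrm_ge0 xi)); exact: (nrm_ev_le evP).
apply: filterS2 (regular_finite_sum_ae F a xi k) xiF => x -> xix.
rewrite (_ : \sum_(h <- F) _ =
    \sum_(h <- F) a h (t k^-1%g x) (if h \in F then (ev xi (k * h)%g : D) x else 0)).
  apply: fiber_boundZ FK _ => h; case: ifP => [/xix//|_].
  by rewrite nrm0 nrm_ge0.
by apply: eq_big_seq => h ->.
Qed.

End regular.

Hypothesis mu_full : measure_support mu = setT.

(** Otherwise the open set would lie in a null set, against the full support of [mu]. *)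
Lemma ae_meets_open (P : borel X -> Prop) (U : set X) :
  {ae mu, forall x, P x} -> open U -> U !=set0 -> exists2 x, U x & P x.
Proof.
move=> [N [mN N0 PN]] oU [x0 Ux0].
apply: contrapT => nP; have UN : U `<=` N.
  by move=> x Ux; apply: PN => Px; apply: nP; exists x.
have : measure_support mu x0 by rewrite mu_full.
move=> /(_ U oU Ux0); rewrite ltNge => /negP; apply.
rewrite -N0; apply: le_measure => //; rewrite inE//.
exact: sub_sigma_algebra.
Qed.

Lemma fiber_sum_bcont (F : {fset G}) (a : G -> bcont X 'L(E)) (e : G -> E) :
  exists f : bcont X E, forall x, f x = \sum_(h <- F) a h x (e h).
Proof.
have app_bcont (b : bcont X 'L(E)) (v : E) : (fun x => b x v) \in bounded_continuous X E.
  rewrite inE; split.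
    apply/continuous_nrmP => x r r0; have d0 : 0 < r / (nrm v + 1).
      by rewrite divr_gt0// ltr_wpDl ?nrm_ge0.
    apply: filterS (bcont_nrmP b x d0) => y.
    rewrite ltr_pdivlMr ?ltr_wpDl ?nrm_ge0//; apply: le_lt_trans.
    rewrite (le_trans (bop_le (b x - b y) v))// ler_wpM2l ?nrm_ge0//.
    by rewrite lerDl.
  exists (nrm b * nrm v) => x _; rewrite (le_trans (bop_le _ _))//.
  by rewrite ler_wpM2r ?nrm_ge0// (nrm_ev_le (@bcont_sup_normed R X 'L(E))).
exists (\sum_(h <- F) BCont (app_bcont (a h) (e h))) => x.
exact: (ev_sum (@bcont_sup_normed R X E)).
Qed.

Lemma open_nrm_gt (f : bcont X E) (K : R) : open [set x | K < nrm (f x)].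
Proof.
rewrite openE => x /= Kx; have e0 : 0 < nrm (f x) - K by rewrite subr_gt0.
apply: filterS (bcont_nrmP f x e0) => y /= xy.
by have := nrm_le_add_dist (f x) (f y); lra.
Qed.

(** For fixed [e] the fibre sum is continuous in [x], so the points violating the bound form an open
    set; one good point in every nonempty open set excludes them all. This passes from almost
    everywhere to everywhere. *)
Lemma fiber_bound_open (F : {fset G}) (a : G -> bcont X 'L(E)) (K : R) :
  (forall (e : G -> E) (U : set X), (forall h, nrm (e h) <= 1) -> open U -> U !=set0 ->
    exists2 x, U x & nrm (\sum_(h <- F) a h x (e h)) <= K) -> fiber_bound F a K.
Proof.
move=> FU x e e1; have [f fE] := fiber_sum_bcont F a e.
rewrite leNgt; apply/negP => Kx.
have [|y /= Ky] := FU e _ e1 (open_nrm_gt f K); first by exists x; rewrite /= fE.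
by rewrite -fE leNgt Ky.
Qed.

Section regular.
Context {H : normedModType R[i]} {ev : H -> G -> D}.
Hypothesis evP : sup_normed ev.
Context {DA : bcont X 'L(E) -> 'L(H)} {V : G -> 'L(H)}.
Hypothesis DE : forall a xi k, ev (DA a xi) k = conj_op M T k a (ev xi k).
Hypothesis VE : forall g xi k, ev (V g xi) k = ev xi (k * g)%g.
Hypothesis finite_ev : forall (F : {fset G}) (z : G -> D),
  exists xi, forall h, ev xi h = if h \in F then z h else 0.

(** The test family has the constant value [e h] at each [h] in [F]. It is read at the coordinate
    [1], where no translation occurs and the fibre sum at [x] itself appears. *)
Lemma regular_nrm_fiber_bound F a K :
  nrm (finite_sum DA V F a) <= K -> fiber_bound F a K.
Proof.
move=> SK; apply: fiber_bound_open => e U e1 oU U0.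
pose p h := LinfFun (step_function_Linf mu (e h) (@measurableT _ (borel X))).
pose c h : D := Linf_class (p h).
have cE h : {ae mu, forall x, c h x = e h}.
  apply: filterS (Linf_reprK (p h)) => x ->.
  by rewrite /= /step_function in_setT.
have [xi xiE] := finite_ev F c.
have xi1 : nrm xi <= 1.
  apply: (nrm_le_ev evP) => // h; rewrite xiE; case: ifP => [_|]; last by rewrite nrm0.
  by apply/Linf_le => //; apply: filterS (cE h) => x ->.
have Sxi : nrm (ev (finite_sum DA V F a xi) 1%g : D) <= K.
  rewrite (le_trans (nrm_ev_le evP _ _))// (le_trans (bop_le _ _))//.
  by rewrite (le_trans _ SK)// ler_piMr ?nrm_ge0.
have K0 := le_trans (nrm_ge0 _) Sxi.
have cF : {ae mu, forall x, forall h, h \in (F : seq G) -> c h x = e h}.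
  exact: ae_forall_seq.
move: Sxi => /(Linf_le _ K0) Sxi.
have sumK : {ae mu, forall x, nrm (\sum_(h <- F) a h x (e h)) <= K}.
  apply: filterS3 Sxi (regular_finite_sum_ae evP DE VE F a xi 1%g) cF => x + Sx cx.
  rewrite Sx invg1 (homeomorphism_group1 t_homeo).
  rewrite (eq_big_seq (fun h => a h x (e h)))// => h hF.
  by rewrite mul1g xiE hF cx.
exact: ae_meets_open sumK oU U0.
Qed.

End regular.

Hypotheses (X_hausdorff : hausdorff_space X) (t_free : topologically_free t).

(** Induction on [s], shrinking the set once for each [k]: by freeness some point of it is moved by
    [t k], and separating that point from its image gives a smaller set disjoint from its image. *)
Lemma wandering_open (s : seq G) (U : set X) : 1%g \notin s -> open U -> U !=set0 ->
  exists V, [/\ open V, V !=set0, V `<=` U &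
    forall k, k \in s -> forall x, V x -> ~ V (t k x)].
Proof.
elim: s U => [|k s IH] U; first by move=> _ oU U0; exists U; split.
rewrite inE negb_or eq_sym => /andP[k1 s1] oU U0.
have [V [oV [x0 Vx0] VU sV]] := IH U s1 oU U0.
have [x Vx kx] : exists2 x, V x & t k x != x.
  apply: contrapT => nV; have := t_free k1; rewrite -subset0 => /(_ x0); apply.
  rewrite /interior; apply: filterS (open_nbhs_nbhs (conj oV Vx0)) => x Vx /=.
  by apply/eqP/negPn/negP => kx; apply: nV; exists x.
move: X_hausdorff; rewrite open_hausdorff => /(_ _ _ kx)[[A B] /= [/set_mem Akx /set_mem Bx] [oA oB /eqP AB]].
(* Points of the new set lie in [B] and their images under [t k] in the disjoint set [A]. *)
exists (V `&` B `&` t k @^-1` A); split.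
- apply: openI; first exact: openI.
  by apply: open_comp oA => y _; exact: (@homeomorphism_group_continuous _ _ _ t_homeo).
- by exists x.
- by move=> y [[/VU]].
move=> h; rewrite inE => /predU1P[-> y [_ Aky] [[_ Bky] _]|hs y [[Vy _] _] [[Vhy _] _]].
  by have : (A `&` B) (t k y) by []; rewrite AB.
exact: sV hs y Vy Vhy.
Qed.

Lemma nrm_fiber_bound F a K : nrm (finite_sum M T F a) <= K -> fiber_bound F a K.
Proof.
move=> SK; apply: fiber_bound_open => e U e1 oU U0.
(* If [t g y] and [t h y] both lie in [V], then the quotient g h^-1 moves a point of [V] into [V];
   avoiding these quotients makes the preimages of [V] disjoint. *)
pose s := [seq (gh.1 * gh.2^-1)%g | gh <- [seq gh <- [seq (g, h) | g <- F, h <- F] | gh.1 != gh.2]].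
have s1 : 1%g \notin s.
  apply/negP => /mapP[[g h]]; rewrite mem_filter /= => /andP[/eqP gh _] gh1.
  by apply: gh; rewrite -[g](mulgVK h) -gh1 mul1g.
have [V [oV V0 VU sV]] := wandering_open s1 oU U0.
have Vdisj g h y : g \in F -> h \in F -> V (t g y) -> V (t h y) -> g = h.
  move=> gF hF Vg Vh; apply/eqP/negPn/negP => gh.
  have : (g * h^-1)%g \in s.
    apply/mapP; exists (g, h) => //; rewrite mem_filter gh /=.
    by apply/allpairsP; exists (g, h).
  move=> /sV /(_ _ Vh); rewrite -(t_homeo.2) -mulgA mulVg mulg1; exact.
have mV h : measurable (t h @^-1` V : set (borel X)).
  apply: sub_sigma_algebra; apply: open_comp oV => y _.
  exact: (@homeomorphism_group_continuous _ _ _ t_homeo).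
pose f : borel X -> E := \sum_(h <- F) step_function (t h @^-1` V : set (borel X)) (e h).
have fL : f \in Linf_function mu E.
  by apply: rpred_sum => h _; exact: step_function_Linf.
have fE h y : h \in F -> V (t h y) -> f y = e h.
  move=> hF Vh; rewrite /f fct_sumE (big_fsetD1 h)//= {1}/step_function mem_set//.
  rewrite big_seq big1 ?addr0// => g; rewrite !inE => /andP[gh gF].
  rewrite /step_function; case: ifPn => // /set_mem Vg.
  by rewrite (Vdisj g h y gF hF Vg Vh) eqxx in gh.
pose u : D := Linf_class (LinfFun fL).
have uf : {ae mu, forall x, u x = f x} by exact: (Linf_reprK (LinfFun fL)).
have u1 : nrm u <= 1.
  apply/Linf_le => //; apply: filterS uf => y ->.
  have [[h [hF Vh]]|nV] := pselect (exists h, h \in F /\ V (t h y)).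
    by rewrite (fE h).
  rewrite /f fct_sumE big_seq big1 ?nrm0// => h hF.
  rewrite /step_function; case: ifPn => // /set_mem Vh.
  by exfalso; apply: nV; exists h.
have Su : nrm (finite_sum M T F a u : D) <= K.
  by rewrite (le_trans (bop_le _ _))// (le_trans _ SK)// ler_piMr ?nrm_ge0.
have K0 := le_trans (nrm_ge0 _) Su.
move: Su => /(Linf_le _ K0) Su.
have uF : {ae mu, forall x, forall h, h \in (F : seq G) -> u (t h^-1%g x) = f (t h^-1%g x)}.
  by apply: ae_forall_seq => h; exact: (ae_translate t_homeo t_mu h^-1%g uf).
have sumK : {ae mu, forall x, V x -> nrm (\sum_(h <- F) a h x (e h)) <= K}.
  apply: filterS3 Su (mult_translation_sumE acts t_homeo t_mu F a u) uF => x + Sx ux Vx.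
  rewrite Sx (eq_big_seq (fun h => a h x (e h)))// => h hF.
  (* For [x] in [V], [t h] sends [t h^-1%g x] back to [x], so that point lies in the preimage on
     which [f] equals [e h]. *)
  by rewrite (ux h hF) (fE h)// (homeomorphism_groupKV t_homeo).
have [x Vx xK] := ae_meets_open sumK oV V0.
by exists x; [exact: VU|exact: xK].
Qed.

End fiberwise_norm.

(** * Coefficients *)

Section coefficients.
Context {R : realType} {X : ptopologicalType} {G : groupType}.
Context {mu : {measure set (borel X) -> \bar R}} {E : normedModType R[i]}.
Context {t : G -> X -> X}.
Variables (acts : acts_by_multiplication mu E).
Variables (t_homeo : homeomorphism_group t) (t_mu : preserves_class mu t).
Hypothesis E_complete : geometrically_complete E.
Hypothesis mu_full : measure_support mu = setT.
Hypotheses (X_hausdorff : hausdorff_space X) (t_free : topologically_free t).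

Local Notation M := (mult_op acts).
Local Notation T := (translation_op t_homeo t_mu).
Local Notation MT := (mult_translation_covariant acts t_homeo t_mu).
Local Notation D := (Linf mu E).
Local Notation A := (bcont X 'L(E)).

Lemma finite_sum_fiber_bound (F : {fset G}) (a : G -> A) :
  fiber_bound F a (nrm (finite_sum M T F a)).
Proof. exact: (nrm_fiber_bound mu_full X_hausdorff t_free (lexx _)). Qed.

(** Each norm is a fibre bound and is dominated by every nonnegative fibre bound, so both are the
    least one. *)
Lemma regular_finite_sum_nrm {H : normedModType R[i]} {ev : H -> G -> D}
    {DA : A -> 'L(H)} {V : G -> 'L(H)} :
  sup_normed ev ->
  (forall a xi k, ev (DA a xi) k = conj_op M T k a (ev xi k)) ->
  (forall g xi k, ev (V g xi) k = ev xi (k * g)%g) ->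
  (forall (F : {fset G}) (z : G -> D),
    exists xi, forall h, ev xi h = if h \in F then z h else 0) ->
  forall F a, nrm (finite_sum DA V F a) = nrm (finite_sum M T F a).
Proof.
move=> evP DE VE finite_ev F a; apply/le_anti/andP; split.
  apply: (fiber_bound_regular_nrm evP DE VE); rewrite ?nrm_ge0//.
  exact: finite_sum_fiber_bound.
apply: fiber_bound_nrm; rewrite ?nrm_ge0//.
exact: (regular_nrm_fiber_bound mu_full evP DE VE finite_ev).
Qed.

(** The scalar moves from [a h] to the vector [e h], and unimodular scalars preserve the unit ball
    of the sup-normed power. Twisting by the inverses gives the converse. *)
Lemma finite_sum_twist_le (F : {fset G}) (a : G -> A) (c : G -> R[i]) :
  (forall h, `|c h| = 1) ->
  nrm (finite_sum M T F (fun h => c h *: a h)) <= nrm (finite_sum M T F a).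
Proof.
move=> c1; apply: fiber_bound_nrm; rewrite ?nrm_ge0// => x e e1.
rewrite (eq_bigr (fun h => a h x (c h *: e h))) => [|h _]; last first.
  by rewrite bopZ bcont_scaleE bop_scaleE.
apply: finite_sum_fiber_bound => h; rewrite nrmZ.
by rewrite (_ : nrm (c h : R[i]^o) = 1) ?mul1r//; apply: complexI; rewrite -nrmE c1.
Qed.

Lemma finite_sum_twist (F : {fset G}) (a : G -> A) (c : G -> R[i]) :
  (forall h, `|c h| = 1) ->
  nrm (finite_sum M T F a) = nrm (finite_sum M T F (fun h => c h *: a h)).
Proof.
move=> c1; apply/le_anti/andP; split; last exact: finite_sum_twist_le.
have cV1 h : `|(c h)^-1| = 1 by rewrite normfV c1 invr1.
have cVK : (fun h => (c h)^-1 *: (c h *: a h)) = a.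
  apply/funext => h; rewrite scalerA mulVf ?scale1r//.
  by rewrite -normr_eq0 c1 oner_eq0.
by have := @finite_sum_twist_le F (fun h => c h *: a h) _ cV1; rewrite cVK.
Qed.

(** Test the fibre operators on vectors concentrated at the single index [g]. *)
Lemma coefficient_nrm_le (F : {fset G}) (a : G -> A) g :
  nrm (extend0 F a g) <= nrm (finite_sum M T F a).
Proof.
rewrite /extend0; case: ifPn => gF; last by rewrite nrm0 nrm_ge0.
apply: (nrm_le_ev (@bcont_sup_normed R X 'L(E))); rewrite ?nrm_ge0// => x.
rewrite [leLHS]nrm_bop; apply: sup_norm_le; rewrite ?nrm_ge0// => v v1.
have := @finite_sum_fiber_bound F a x (fun h => if h == g then v else 0).
rewrite (big_fsetD1 g)//= eqxx big_seq big1 ?addr0; last first.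
  by move=> h; rewrite !inE => /andP[/negbTE-> _]; exact: linear0.
by apply=> h; case: ifP; rewrite ?nrm0.
Qed.

Lemma mult_op_nrm_le (a : A) : nrm (M a) <= nrm a.
Proof.
apply: bop_nrm_le; rewrite ?nrm_ge0// => u.
apply/(Linf_le _ (mulr_ge0 (nrm_ge0 a) (nrm_ge0 u))).
have [uu _] := Linf_le u (nrm_ge0 u).
apply: filterS2 (mult_opE acts a u) (uu (lexx _)) => x -> ux.
rewrite (le_trans (bop_le _ _))// ler_pM ?nrm_ge0//.
exact: (nrm_ev_le (@bcont_sup_normed R X 'L(E))).
Qed.

Let coefficient_graph g := sum_graph (finite_sum M T) (fun F (a : G -> A) => extend0 F a g).

Let coefficient_graph_linear g (l : R[i]) b c b' c' :
  coefficient_graph g b c -> coefficient_graph g b' c' ->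
  coefficient_graph g (l *: b + b') (l *: c + c').
Proof.
by apply: sum_graph_linear; [exact: finite_sum_sum_like MT|exact: coefficient_sum_like].
Qed.

Let coefficient_graph_le g b c : coefficient_graph g b c -> nrm c <= nrm b.
Proof. by move=> [F [a [-> ->]]]; exact: coefficient_nrm_le. Qed.

Lemma sum_graph_dom (W : lmodType R[i]) (Psi : {fset G} -> (G -> A) -> W) :
  crossed_algebra M T = closure [set b | exists c, sum_graph (finite_sum M T) Psi b c].
Proof.
congr closure; apply/seteqP; split=> b /=; first by move=> [F [a ->]]; exists (Psi F a), F, a.
by move=> [c [F [a [-> _]]]]; exists F, a.
Qed.

Definition coefficient g : 'L(D) -> A := graph_extension (coefficient_graph g).

Let A_complete : geometrically_complete A.
Proof. exact/bcont_complete/bop_complete. Qed.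

Lemma coefficientE g F a : coefficient g (finite_sum M T F a) = extend0 F a g.
Proof.
apply: (graph_extensionE (@coefficient_graph_linear g) (@coefficient_graph_le g)).
by apply: sub_graph_closure; exists F, a.
Qed.

Lemma coefficient_mapP g : coefficient_map M T g (coefficient g).
Proof.
split; last exact: coefficientE.
rewrite (sum_graph_dom (fun F a => extend0 F a g)).
exact: (graph_extension_continuous (@coefficient_graph_linear g) (@coefficient_graph_le g)).
Qed.

(** Used when the coefficients of [b] vanish: those of any approximating sum are then no larger than
    its distance to [b]. *)
Lemma coefficient_dist g b F a : crossed_algebra M T b ->
  nrm (coefficient g b - extend0 F a g) <= nrm (b - finite_sum M T F a).
Proof.
rewrite (sum_graph_dom (fun F a => extend0 F a g)) => Bb.
apply: (graph_closure_dist (@coefficient_graph_linear g) (@coefficient_graph_le g)).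
  exact: (graph_extensionP (@coefficient_graph_linear g) (@coefficient_graph_le g)).
by apply: sub_graph_closure; exists F, a.
Qed.

Lemma coefficient0 g : coefficient g 0 = 0.
Proof.
have := coefficientE g fset0 (fun=> 0).
by rewrite /finite_sum big_seq_fset0 => ->; rewrite /extend0 inE.
Qed.

Let T_contr := @translation_op_contraction R X G mu E t t_homeo t_mu.
Local Notation DA := (diag_l0 M T_contr).
Local Notation V := (@shift_l0 R G D).

(* The image of [b] in the regular representation has the matrix entries
   [T_g a_k T_g^-1], with [a_k] the coefficients of [b]; on [l_0(G, D)] an operator with
   zero matrix is zero. *)
Lemma coefficient_eq0 b : crossed_algebra M T b ->
  (forall g, coefficient g b = 0) -> b = 0.
Proof.
move=> Bb b0; have evP := @l0_sup_normed R G D.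
have DV := l0_covariant MT T_contr.
pose P := sum_graph (finite_sum M T) (finite_sum DA V).
have P_linear (l : R[i]) b1 c1 b2 c2 : P b1 c1 -> P b2 c2 ->
    P (l *: b1 + b2) (l *: c1 + c2).
  by apply: sum_graph_linear; [exact: finite_sum_sum_like MT|exact: finite_sum_sum_like DV].
have P_iso b1 c1 : P b1 c1 -> nrm c1 = nrm b1.
  move=> [F [a [-> ->]]].
  exact: (regular_finite_sum_nrm evP (diag_l0E T_contr) (@shift_l0E _ _ _) (@l0_finiteP _ _ _)).
have P_le b1 c1 : P b1 c1 -> nrm c1 <= nrm b1 by move=> /P_iso ->.
have lc : geometrically_complete 'L(l0 G D).
  exact/bop_complete/l0_complete/Linf_complete.
have [c bc] : exists c, graph_closure P b c.
  apply: graph_closure_exists => //.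
  by move: Bb; rewrite (sum_graph_dom (finite_sum DA V)).
(* [c] is the image of [b] in the regular representation and has the same norm. *)
apply: nrm_eq0; rewrite -(graph_closure_isometry P_iso bc).
suff -> : c = 0 by rewrite nrm0.
apply: l0_bop_eq0 => h z; apply: (ev_inj evP) => g.
apply: nrm_sub_le_small => e e0; rewrite (ev0 evP) subr0.
(* Two errors, [c1] from replacing [c] by a sum and [c2] from the small coefficient of that sum,
   each cost this tolerance times [nrm z]. *)
have d0 : 0 < e / (2 * nrm z + 1) by rewrite divr_gt0// ltr_wpDl// mulr_ge0 ?nrm_ge0.
have [_ [_ [[F [a [-> ->]]] bF cF]]] := bc _ d0.
set xi := l0_finite _ _; set k := (g^-1 * h)%g.
have xiz : nrm xi <= nrm z.
  by apply: (nrm_le_ev evP); rewrite ?nrm_ge0// => j /=; case: ifP; rewrite ?nrm0 ?nrm_ge0.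
have ak : nrm (extend0 F a k) < e / (2 * nrm z + 1).
  apply: le_lt_trans bF; have := coefficient_dist k F a Bb.
  by rewrite b0 sub0r nrmN.
have c1 : nrm (c xi g - finite_sum DA V F a xi g) <= e / (2 * nrm z + 1) * nrm z.
  apply: le_trans (nrm_ev_le evP (c xi - finite_sum DA V F a xi) g) _.
  rewrite (le_trans (bop_le (c - finite_sum DA V F a) xi))//.
  by rewrite ler_pM ?nrm_ge0// ltW.
have c2 : nrm (finite_sum DA V F a xi g) <= e / (2 * nrm z + 1) * nrm z.
  have xiE j : xi j = if j == h then z else 0 by rewrite /= inE.
  rewrite (regular_finite_sum_delta MT evP (diag_l0E T_contr) (@shift_l0E _ _ _) _ _ xiE).
  rewrite (le_trans (conj_op_le M T_contr _ _ _))//.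
  by rewrite ler_wpM2r ?nrm_ge0// (le_trans (mult_op_nrm_le _))// ltW.
rewrite (le_trans (nrm_le_add_dist _ (finite_sum DA V F a xi g)))//.
rewrite (le_trans (lerD c2 c1))//.
have : e / (2 * nrm z + 1) * (2 * nrm z + 1) = e.
  by rewrite divfK// gt_eqF// ltr_wpDl// mulr_ge0 ?nrm_ge0.
by move: d0; set d := e / _; lra.
Qed.

End coefficients.

(** * Isomorphism with both regular representations, coefficients and characters *)

Theorem lemma6p4 (R : realType) (X : ptopologicalType)
    (mu : {measure set (borel X) -> \bar R}) (E : completeNormedModType R[i])
    (G : groupType) (t : G -> X -> X)
    (X_completely_regular : completely_regular_space X)
    (X_hausdorff : hausdorff_space X)
    (mu_full : measure_support mu = setT)
    (E_neq0 : exists e : E, e != 0)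
    (A_acts : acts_by_multiplication mu E)
    (t_homeo : homeomorphism_group t)
    (t_mu : preserves_class mu t)
    (t_free : topologically_free t) :
  let M := mult_op A_acts in
  let T := translation_op t_homeo t_mu in
  let T_contr := translation_op_contraction t_homeo t_mu in
  [/\ canonically_isomorphic M T (diag_l0 M T_contr) (@shift_l0 R G (Linf mu E)),
      canonically_isomorphic M T (diag_linf M T_contr) (@shift_linf R G (Linf mu E)),
      property_star M T,
      property_starstar M T
    & forall (F : {fset G}) (a : G -> bcont X 'L(E)) (chi : G -> R[i]),
        character chi ->
        `|finite_sum M T F a| = `|finite_sum M T F (fun g => chi g *: a g)|].
Proof.
move=> M T T_contr.
have Ec := complete_geometrically_complete (V := E).
have Dc := Linf_complete (mu := mu) Ec.
have MT : covariant _ _ _ M T := mult_translation_covariant A_acts t_homeo t_mu.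
have star : property_star M T.
  move=> F a F1; rewrite !nrmE lecR.
  have := @coefficient_nrm_le _ _ _ _ _ _ A_acts t_homeo t_mu mu_full X_hausdorff t_free F a 1%g.
  by rewrite /extend0 F1.
split.
- apply: (canonically_isomorphic_nrm MT (l0_covariant MT T_contr) Dc (l0_complete Dc)).
  exact: (regular_finite_sum_nrm mu_full X_hausdorff t_free (@l0_sup_normed R G _)
    (diag_l0E T_contr) (@shift_l0E _ _ _) (@l0_finiteP _ _ _)).
- apply: (canonically_isomorphic_nrm MT (linf_covariant MT T_contr) Dc (linf_complete Dc)).
  exact: (regular_finite_sum_nrm mu_full X_hausdorff t_free (@linf_sup_normed R G _)
    (diag_linfE T_contr) (@shift_linfE _ _ _) (@linf_finiteP _ _ _)).
- exact: star.
- split; first exact: star.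
  exists (coefficient A_acts t_homeo t_mu).
    by move=> g; exact: coefficient_mapP.
  move=> b Bb; split=> [-> g|]; first exact: coefficient0.
  exact: coefficient_eq0.
- move=> F a chi [chi1 _]; rewrite !nrmE.
  by rewrite (@finite_sum_twist _ _ _ _ _ _ A_acts t_homeo t_mu mu_full X_hausdorff t_free
    F a chi chi1).
Qed.
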